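(* Consider instances of Conditional Minisum (CMS) in which the dependency graph of every voter has maximum in-degree at most $1$ and the undirected version of the global dependency graph has treewidth at most $2$. Then CMS is optimally solvable in polynomial time on such instances.
   Context: CMS: binary issues $I_1,\dots,I_m$, each with a two-element domain, and voters $1,\dots,n$; voter $i$ has a directed dependency graph $G_i=(\{I_1,\dots,I_m\},E_i)$ and for each issue $I_j$ a set $B_i^j$ of approved statements $\{t:d\}$ ($d$ a value of $I_j$, $t$ an assignment to the in-neighbours of $I_j$ in $G_i$). Under outcome $s$, voter $i$ is dissatisfied with $I_j$ if $\{t:s_j\}\notin B_i^j$ where $t$ is the projection of $s$ onto the in-neighbours of $I_j$ in $G_i$; CMS asks for an outcome minimizing the total number of (voter, issue) dissatisfactions. The global dependency graph is the directed graph on the issues with edge set $\bigcup_i E_i$. Its undirected version is the simple undirected graph obtained by forgetting edge orientations (with a single undirected edge when both $(x,y)$ and $(y,x)$ are present). *)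

(* Defs.v *)
From mathcomp Require Import all_boot.
Set Implicit Arguments. Unset Strict Implicit. Unset Printing Implicit Defensive.

(* CMS instances (issues are 0..m-1, values of an issue are booleans)  *)

(* A statement {t : d}: t is an assignment (issue, value) to the
   in-neighbours of the issue, d the value of the issue. *)
Definition statement := (seq (nat * bool) * bool)%type.

(* A voter: the edge list E_i of G_i (pairs (x,y) = edge x -> y) and,
   for each issue j < m, the list B_i^j of approved statements. *)
Record voter := Voter { vedges : seq (nat * nat);
                        vapp : seq (seq statement) }.

Record instance := Inst { nissues : nat; voters : seq voter }.

Definition voter0 : voter := Voter [::] [::].
Definition all_voters (I : instance) (P : voter -> Prop) : Prop :=
  forall i, i < size (voters I) -> P (nth voter0 (voters I) i).

Definition in_nbrs (v : voter) (j : nat) : seq nat :=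
  undup [seq e.1 | e <- vedges v & e.2 == j].

Definition wf_instance (I : instance) : Prop :=
  all_voters I (fun v =>
    [/\ forall e, e \in vedges v ->
          [/\ e.1 < nissues I, e.2 < nissues I & e.1 != e.2],
        size (vapp v) = nissues I &
        forall j, j < nissues I -> forall st, st \in nth [::] (vapp v) j ->
          uniq (map fst st.1) /\ perm_eq (map fst st.1) (in_nbrs v j)]).

Definition max_indeg_le1 (I : instance) : Prop :=
  all_voters I (fun v => forall j, j < nissues I ->
    size (in_nbrs v j) <= 1).

Definition dissat (v : voter) (j : nat) (s : seq bool) : bool :=
  ~~ has (fun st : statement => (st.2 == nth false s j) &&
                               all (fun p => nth false s p.1 == p.2) st.1)
        (nth [::] (vapp v) j).

Definition cms_cost (I : instance) (s : seq bool) : nat :=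
  \sum_(v <- voters I) \sum_(j < nissues I) dissat v j s.

Definition cms_optimal (I : instance) (s : seq bool) : Prop :=
  size s = nissues I /\
  forall s', size s' = nissues I -> cms_cost I s <= cms_cost I s'.

Definition und_global (I : instance) : rel 'I_(nissues I) :=
  fun x y => (x != y) &&
    has (fun v => ((x : nat, y : nat) \in vedges v) ||
                  ((y : nat, x : nat) \in vedges v)) (voters I).

(* A tree on nodes 'I_p.+1 given by a parent function (par i < i for i > 0,
   node 0 is the root); every finite tree admits such a labelling. *)
Definition tree_adj (p : nat) (par : 'I_p.+1 -> 'I_p.+1) : rel 'I_p.+1 :=
  fun a b => ((0 < a) && (par a == b)) || ((0 < b) && (par b == a)).

Definition tree_decomposition (V : finType) (g : rel V) (w : nat)
    (p : nat) (par : 'I_p.+1 -> 'I_p.+1) (bag : 'I_p.+1 -> {set V}) : Prop :=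
  [/\ forall i : 'I_p.+1, 0 < i -> par i < i,
      forall x : V, exists i, x \in bag i,
      forall x y : V, g x y -> exists i, (x \in bag i) && (y \in bag i),
      forall (x : V) (a b : 'I_p.+1), x \in bag a -> x \in bag b ->
        connect [rel u v | [&& x \in bag u, x \in bag v & tree_adj par u v]] a b
    & forall i, #|bag i| <= w.+1].

Definition treewidth_le (V : finType) (g : rel V) (w : nat) : Prop :=
  exists p par bag, @tree_decomposition V g w p par bag.

Inductive sym := SA | SB | SL | SR.
Inductive move := MLeft | MRight | MStay.

Section TM.
Variables (W Q : finType).
(* tape symbols: None = blank, inl = input/output symbol, inr = work symbol *)
Definition tsym := option (sym + W).

Record config := Config { cst : Q; cleft : seq tsym; chead : tsym; cright : seq tsym }.

Variables (delta : Q -> tsym -> Q * tsym * move) (qf : Q).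

Definition tm_step (c : config) : config :=
  if cst c == qf then c else
  let: (q', a, mv) := delta (cst c) (chead c) in
  match mv with
  | MStay => Config q' (cleft c) a (cright c)
  | MLeft => match cleft c with
             | [::] => Config q' [::] None (a :: cright c)
             | b :: l => Config q' l b (a :: cright c)
             end
  | MRight => match cright c with
             | [::] => Config q' (a :: cleft c) None [::]
             | b :: r => Config q' (a :: cleft c) b r
             end
  end.

Definition init_config (q0 : Q) (x : seq sym) : config :=
  match x with
  | [::] => Config q0 [::] None [::]
  | a :: r => Config q0 [::] (Some (inl a)) (map (fun b => Some (inl b)) r)
  end.

Fixpoint read_out (s : seq tsym) : seq sym :=
  match s with
  | Some (inl a) :: s' => a :: read_out s'
  | _ => [::]
  end.

(* started in q0 on input x, the machine is in the halting state qf after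
   t steps (hence has halted within t steps) with output y. *)
Definition tm_runs (q0 : Q) (x : seq sym) (t : nat) (y : seq sym) : Prop :=
  let c := iter t tm_step (init_config q0 x) in
  cst c = qf /\ read_out (chead c :: cright c) = y.
End TM.

Definition enc_nat (k : nat) : seq sym := nseq k SA ++ [:: SB].
Definition enc_bool (b : bool) : seq sym := enc_nat (nat_of_bool b).
Definition enc_list (T : Type) (f : T -> seq sym) (s : seq T) : seq sym :=
  SL :: (flatten (map f s) ++ [:: SR]).
Definition enc_stmt (st : statement) : seq sym :=
  enc_list (fun p => enc_nat p.1 ++ enc_bool p.2) st.1 ++ enc_bool st.2.
Definition enc_voter (v : voter) : seq sym :=
  enc_list (fun e => enc_nat e.1 ++ enc_nat e.2) (vedges v) ++
  enc_list (enc_list enc_stmt) (vapp v).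
Definition enc_instance (I : instance) : seq sym :=
  enc_nat (nissues I) ++ enc_list enc_voter (voters I).
Definition enc_outcome (s : seq bool) : seq sym := enc_list enc_bool s.

(* Main.v *)
From HB Require Import structures.
Require Import Defs.
From mathcomp Require Import all_boot zify.
Set Implicit Arguments. Unset Strict Implicit. Unset Printing Implicit Defensive.

(* With in-degrees at most 1 the cost is a sum of factors on at most two binary
   variables each.  A graph of treewidth at most 2 has a vertex x with at most
   two neighbours y, z; minimising over x replaces all factors containing x by
   one factor on (y, z), and the new graph is a contraction of the old one, so
   that its treewidth is still at most 2.  After all variables are eliminated, an
   optimal outcome is read off by choosing the values in reverse order.  The sum
   over the factors of their largest entries never increases, so the numbers stay
   polynomially bounded even in unary.

   The algorithm is a composition of functions on lists and numbers that belong
   to a class closed under composition and under folds with polynomially bounded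
   intermediate results.  Every function of the class is computed by a
   program on four stacks, the data being serialised binary trees, and four
   stacks are simulated by the tracks of one tape. *)

(** * Simulating four stacks on one tape *)

(** The machine never sees a tree decomposition: it eliminates any variable with at most two
    neighbours, and decompositions occur only in the correctness proof. The invariant must therefore
    survive the elimination of an arbitrary such variable, not just of one in a leaf bag, and
    contraction provides this. Treewidth 2 is exactly what keeps the algorithm within pairs, since a
    variable with two neighbours leaves a factor on two variables. In-degree at most 1 makes every
    satisfaction condition a factor on an issue and its only in-neighbour, so that two variables
    sharing a factor are adjacent in the global dependency graph; a larger in-degree would also join
    in-neighbours with each other.

    A fold must come with a bound on all its intermediate results, because iterating a
    polynomial-time step may otherwise grow exponentially. Four stacks suffice because the tree on
    top of one of them can be copied, swapped or dropped with two buffers and a counter. Time bounds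
    are proved for every input word, well-formed or not, so that running time and correctness are
    treated separately. *)

Definition sym_bits (a : sym) : bool * bool :=
  match a with
  | SA => (false, false) | SB => (false, true)
  | SL => (true, false) | SR => (true, true)
  end.
Definition bits_sym (b : bool * bool) : sym :=
  match b with
  | (false, false) => SA | (false, true) => SB
  | (true, false) => SL | (true, true) => SR
  end.
Lemma sym_bitsK : cancel sym_bits bits_sym.
Proof. by case. Qed.
HB.instance Definition _ := Finite.copy sym (can_type sym_bitsK).

Definition reg := (bool * bool)%type.
Definition stacks := {ffun reg -> seq sym}.

Definition upd (st : stacks) (i : reg) (s : seq sym) : stacks :=
  [ffun j => if j == i then s else st j].

Section Reach.
Variables (T : Type) (f : T -> T).

(** An upper bound on the number of steps instead of an exact count, so that bounds add up along a
    run and can be rounded up. *)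
Definition reach (n : nat) (P : T -> Prop) (x : T) : Prop :=
  exists2 t, t <= n & P (iter t f x).

Lemma reach0 n (P : T -> Prop) x : P x -> reach n P x.
Proof. by exists 0. Qed.

Lemma reachS n (P : T -> Prop) x : reach n P (f x) -> reach n.+1 P x.
Proof. by case=> t tn Pt; exists t.+1 => //; rewrite iterSr. Qed.

Lemma reach_trans n m (P R : T -> Prop) x :
  reach n P x -> (forall y, P y -> reach m R y) -> reach (n + m) R x.
Proof.
case=> t tn /[swap] h /h [t' tm Rt]; exists (t' + t); last by rewrite iterD.
by rewrite addnC leq_add.
Qed.

Lemma reach_imp n (P R : T -> Prop) x :
  (forall y, P y -> R y) -> reach n P x -> reach n R x.
Proof. by move=> PR [t tn /PR]; exists t. Qed.

Lemma reach_le n m (P : T -> Prop) x : n <= m -> reach n P x -> reach m P x.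
Proof. by move=> nm [t tn Pt]; exists t => //; apply: leq_trans nm. Qed.
End Reach.

Section Simulation.
Variables (X : finType) (exit : X).
Variables (act : X -> reg * option sym) (nxt : X -> option sym -> X).

(* act x = (i, Some a) pushes a on stack i; act x = (i, None) pops stack i. *)
Definition sstep (c : X * stacks) : X * stacks :=
  let: (x, st) := c in
  if x == exit then c else
  let: (i, o) := act x in
  if o is Some a then (nxt x None, upd st i (a :: st i))
  else (nxt x (ohead (st i)), upd st i (behead (st i))).

Definition cell := {ffun reg -> option sym}.
Definition track0 : reg := (false, false).
Definition cell_input (a : sym) : cell :=
  [ffun i => if i == track0 then Some a else None].

(* A raw input symbol is read as a cell all of whose tracks but the first are
   empty; writing in this canonical form makes loading the input and printing
   the output free. *)
Definition cell_enc (w : cell) : tsym cell :=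
  if w == [ffun=> None] then None else
  if w track0 is Some a then
    if w == cell_input a then Some (inl a) else Some (inr w)
  else Some (inr w).
Definition cell_dec (a : tsym cell) : cell :=
  match a with
  | None => [ffun=> None]
  | Some (inl a) => cell_input a
  | Some (inr w) => w
  end.

Lemma cell_encK : cancel cell_enc cell_dec.
Proof.
move=> w; rewrite /cell_enc; case: eqP => [->//|_].
by case: (w track0) => [a|//]; case: eqP.
Qed.

Lemma cell_enc_none w : cell_enc w = None -> forall i, w i = None.
Proof. by move/(congr1 cell_dec); rewrite cell_encK => -> i; rewrite ffunE. Qed.

(** The top of every stack stays in the first cell after the left marker, so a push or pop shifts a
    whole track. [PushR a] walks right carrying the displaced symbol and [Ret] walks back to the
    marker; [PopR] walks to the end of the track and [PopL o] walks back, moving each symbol one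
    cell to the left, so that the former top is in hand at the marker. *)
Definition phase := (option sym + option sym + bool)%type.
Notation Go := (inl (inl None)).
Notation PushR a := (inl (inl (Some a))).
Notation PopL o := (inl (inr o)).
Notation Ret := (inr false).
Notation PopR := (inr true).

Definition wset (w : cell) i o : cell := [ffun j => if j == i then o else w j].

Definition sim_delta (q : X * phase) (a : tsym cell) :
    (X * phase) * tsym cell * move :=
  let: (x, ph) := q in
  let i := (act x).1 in
  let w := cell_dec a in
  match ph with
  | Go => if (act x).2 is Some b then ((x, PushR b), a, MStay)
          else ((x, PopR), a, MStay)
  | PushR b =>
      if w i is Some d then ((x, PushR d), cell_enc (wset w i (Some b)), MRight)
      else ((nxt x None, Ret), cell_enc (wset w i (Some b)), MLeft)
  | Ret => if a is None then ((x, Go), a, MRight) else ((x, Ret), a, MLeft)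
  | PopR => if w i is Some _ then ((x, PopR), a, MRight)
            else ((x, PopL None), a, MLeft)
  | PopL o => if a is None then ((nxt x o, Go), None, MRight)
              else ((x, PopL (w i)), cell_enc (wset w i o), MLeft)
  end.

Definition sim_halt : X * phase := (exit, Go).
Notation step := (tm_step sim_delta sim_halt).

Lemma neq_halt x ph : ph <> Go -> (x, ph) != sim_halt.
Proof. by move=> ne; apply/eqP => -[_ /ne]. Qed.

(** Positions are absolute, with blanks left of position 0. Comparison through [nth] with default
    [None] identifies tapes that differ only in trailing blanks. *)
Definition tape_at (q : X * phase) (p : nat) (f : nat -> tsym cell)
    (c : config cell (X * phase)%type) : Prop :=
  [/\ cst c = q,
      forall j, nth None (cleft c) j = (if j < p then f (p - j.+1) else None)
    & forall j, nth None (chead c :: cright c) j = f (p + j)].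

Lemma tape_at_ext q p f g c : f =1 g -> tape_at q p f c -> tape_at q p g c.
Proof. by move=> fg [? hl hr]; split=> // j; rewrite -fg. Qed.

Definition fset (f : nat -> tsym cell) (p : nat) a j := if j == p then a else f j.

Lemma fset_id f p : fset f p (f p) =1 f.
Proof. by move=> j; rewrite /fset; case: eqP => // ->. Qed.

Lemma step_stay q p f c q' a : tape_at q p f c -> q != sim_halt ->
  sim_delta q (f p) = (q', a, MStay) -> tape_at q' p (fset f p a) (step c).
Proof.
case: c => [q0 l h r] [/= -> hl hr] nq; have := hr 0; rewrite addn0 /= => -> e.
rewrite /tm_step /= (negbTE nq) e; split=> //= j; rewrite /fset.
  by rewrite hl; case: ltnP => // jp; case: eqP => //; lia.
case: j => [|j]; first by rewrite addn0 eqxx.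
by have /= -> := hr j.+1; case: eqP => //; lia.
Qed.

Lemma step_right q p f c q' a : tape_at q p f c -> q != sim_halt ->
  sim_delta q (f p) = (q', a, MRight) ->
  tape_at q' p.+1 (fset f p a) (step c).
Proof.
case: c => [q0 l h r] [/= -> hl hr] nq; have := hr 0; rewrite addn0 /= => -> e.
have hl' : forall j, nth None (a :: l) j =
    if j < p.+1 then fset f p a (p.+1 - j.+1) else None.
  case=> [|j] /=; rewrite /fset; first by rewrite subn1 /= eqxx.
  by rewrite hl ltnS; case: ltnP => // jp; case: eqP => [|_]; [lia | rewrite subSS].
rewrite /tm_step /= (negbTE nq) e.
case: r hr => [|b r] hr; split=> //= j.
  have := hr j.+1; rewrite /fset /=; case: eqP => [|_]; first lia.
  by rewrite nth_nil addnS addSn => <-; case: j => [|j] //=; rewrite nth_nil.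
have := hr j.+1; rewrite /fset /=; case: eqP => [|_]; first lia.
by rewrite addnS addSn.
Qed.

Lemma step_left q p f c q' a : tape_at q p.+1 f c -> q != sim_halt ->
  sim_delta q (f p.+1) = (q', a, MLeft) ->
  tape_at q' p (fset f p.+1 a) (step c).
Proof.
case: c => [q0 l h r] [/= -> hl hr] nq; have := hr 0; rewrite addn0 /= => -> e.
rewrite /tm_step /= (negbTE nq) e.
have hr' b : b = f p -> forall j, nth None [:: b, a & r] j = fset f p.+1 a (p + j).
  move=> -> [|[|j]]; rewrite /fset /=.
  - by rewrite addn0; case: eqP => //; lia.
  - by rewrite addn1 eqxx.
  - by have /= -> := hr j.+1; case: eqP => [|_]; [lia | rewrite !addnS !addSn].
case: l hl => [|b l] hl; (split => //; last first).
- by apply: hr'; have := hl 0; rewrite /= subn1 /=.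
- move=> j /=; have := hl j.+1; rewrite /= nth_nil ltnS subSS /fset => ->.
  by case: ltnP => // jp; case: eqP => //; lia.
- by apply: hr'; have := hl 0; rewrite /= subn1 /=.
- move=> j /=; have := hl j.+1; rewrite /= ltnS subSS /fset => ->.
  by case: ltnP => // jp; case: eqP => //; lia.
Qed.

(* Position 0 is a blank marking the left end; position j.+1 holds the j-th
   symbols of all tracks. *)
Definition cells (S : reg -> nat -> option sym) (p : nat) : tsym cell :=
  if p is j.+1 then cell_enc [ffun i => S i j] else None.

Lemma cells_ext S S' : (forall i, S i =1 S' i) -> cells S =1 cells S'.
Proof.
move=> e [|j] //=; congr cell_enc; apply/ffunP => i; rewrite !ffunE; exact: e.
Qed.

Definition Sset (S : reg -> nat -> option sym) i p o i' j :=
  if (i' == i) && (j == p) then o else S i' j.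

Lemma cells_set S p i o :
  fset (cells S) p.+1 (cell_enc (wset [ffun i => S i p] i o)) =1
  cells (Sset S i p o).
Proof.
case=> [|j] //=; rewrite /fset eqSS; case: eqP => [->|ne] /=; congr cell_enc;
  apply/ffunP => i'; rewrite !ffunE /Sset.
  by rewrite eqxx andbT; case: eqP.
by case: (j =P p) => //; rewrite andbF.
Qed.

(** [b] is the symbol in transit and [l] the part of the track still to be shifted. The last write
    is one cell to the right of the final head position, because the machine turns back in the same
    step. *)
Lemma push_right x p b c S l (i := (act x).1) :
  (forall j, S i (p + j) = onth l j) ->
  tape_at (x, PushR b) p.+1 (cells S) c ->
  reach step (size l).+1
    (tape_at (nxt x None, Ret) (p + size l)
      (cells (fun i' j => if (i' == i) && (p <= j) then onth (b :: l) (j - p)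
                          else S i' j))) c.
Proof.
elim: l => [|d l IH] in p b S c * => Sl ht; apply: reachS.
  apply: reach0; apply: tape_at_ext; last rewrite addn0; last first.
    apply: (step_left ht) => /=; first exact: neq_halt.
    by rewrite cell_encK ffunE -/i; have := Sl 0; rewrite addn0 => ->.
  move=> j; rewrite cells_set; apply: cells_ext => {}j i'.
  rewrite /Sset; case: eqP => //= ->.
  case: ltngtP => [jp|jp|->]; rewrite ?subnn //.
  have := Sl (i' - p); rewrite subnKC ?(ltnW jp) // => ->.
  by case E: (i' - p) => [|k]; [lia | rewrite /= onth0n].
apply: reach_imp; last first.
  apply: (IH p.+1 d (Sset S i p (Some b))) => [j|].
    rewrite /Sset eqxx /=; case: eqP => [|_]; first lia.
    by have := Sl j.+1; rewrite addnS addSn.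
  apply: tape_at_ext; first exact: cells_set.
  apply: (step_right ht) => /=; first exact: neq_halt.
  by rewrite cell_encK ffunE -/i; have := Sl 0; rewrite addn0 => ->.
move=> c' hc; rewrite /= addnS -addSn.
apply: tape_at_ext hc; apply: cells_ext => i' j; rewrite /Sset.
case: eqP => //= _; case: ltngtP => // [jp|->]; last by rewrite subnn.
by rewrite -(subnSK jp).
Qed.

(** [Ret] stops at the first blank cell, and a cell is blank when all its tracks are empty. The
    hypothesis excludes this between the marker and the head. *)
Lemma return_left x p c S :
  (forall j, j < p -> exists i, S i j <> None) ->
  tape_at (x, Ret) p (cells S) c ->
  reach step p.+1 (tape_at (x, Go) 1 (cells S)) c.
Proof.
elim: p => [|p IH] in c * => Sl ht; apply: reachS.
  apply: reach0; apply: tape_at_ext; first exact: (fset_id (cells S) 0).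
  by apply: (step_right ht); first exact: neq_halt.
apply: IH => [j jp|]; first by apply: Sl; rewrite ltnW.
apply: tape_at_ext; first exact: (fset_id (cells S) p.+1).
apply: (step_left ht) => /=; first exact: neq_halt.
case E: cell_enc => [a|] //.
have [i []] := Sl p (ltnSn p); have := cell_enc_none E i.
by rewrite ffunE.
Qed.

Lemma pop_right x p c S l (i := (act x).1) :
  (forall j, S i (p + j) = onth l j) ->
  tape_at (x, PopR) p.+1 (cells S) c ->
  reach step (size l).+1 (tape_at (x, PopL None) (p + size l) (cells S)) c.
Proof.
elim: l => [|d l IH] in p c * => Sl ht; apply: reachS.
  apply: reach0; apply: tape_at_ext; first exact: (fset_id (cells S) p.+1).
  rewrite addn0; apply: (step_left ht) => /=; first exact: neq_halt.
  by rewrite cell_encK ffunE -/i; have := Sl 0; rewrite addn0 => ->.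
rewrite /= addnS -addSn; apply: IH => [j|].
  by have := Sl j.+1; rewrite addnS addSn.
apply: tape_at_ext; first exact: (fset_id (cells S) p.+1).
apply: (step_right ht) => /=; first exact: neq_halt.
by rewrite cell_encK ffunE -/i; have := Sl 0; rewrite addn0 => ->.
Qed.

(** [o] is the symbol picked up one cell further right. On arrival at the marker the symbol in
    transit is the popped one, and it selects the next state. *)
Lemma pop_left x p c S o (i := (act x).1) :
  (forall j, j < p -> S i j <> None) ->
  tape_at (x, PopL o) p (cells S) c ->
  reach step p.+1
    (tape_at (nxt x (if p is 0 then o else S i 0), Go) 1
      (cells (fun i' j => if (i' == i) && (j < p)
                          then (if j.+1 == p then o else S i j.+1)
                          else S i' j))) c.
Proof.
elim: p => [|p IH] in c o S * => Sl ht; apply: reachS.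
  apply: reach0; apply: tape_at_ext; last by apply: (step_right ht); first exact: neq_halt.
  move=> j; rewrite (fset_id (cells S) 0) //; apply: cells_ext => i' k.
  by rewrite ltn0 andbF.
have ne : cell_enc [ffun i => S i p] <> None.
  by move/cell_enc_none/(_ i); rewrite ffunE; apply: Sl.
have {}ht : tape_at (x, PopL (S i p)) p (cells (Sset S i p o)) (step c).
  apply: tape_at_ext; first exact: cells_set.
  apply: (step_left ht) => /=; first exact: neq_halt.
  case E: cell_enc ne => [a|//] _.
  by rewrite -E cell_encK ffunE.
apply: reach_imp; last first.
  apply: (IH _ _ _ _ ht) => j jp; rewrite /Sset eqxx /=.
  by case: eqP => [|_]; [lia | apply: Sl; rewrite ltnW].
move=> c' hc.
have -> : S i 0 = (if p is 0 then S i p else Sset S i p o i 0).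
  by case: (p) => [|p'] //; rewrite /Sset eqxx.
apply: tape_at_ext hc; apply: cells_ext => i' j; rewrite /Sset.
case: eqP => [->|//] /=; rewrite eqxx /= ltnS eqSS.
by case: (ltngtP j p) => // jp; case: eqP => [->|].
Qed.

Definition simulates (x : X) (st : stacks) c := tape_at (x, Go) 1 (cells (fun i => onth (st i))) c.

(** One dispatching step, a walk along the track and a walk back. *)
Lemma sim_step x (st : stacks) c n : (forall i, size (st i) <= n) -> simulates x st c ->
  reach step (2 * n + 4) (simulates (sstep (x, st)).1 (sstep (x, st)).2) c.
Proof.
move=> stn hc; rewrite /sstep; case: eqP => [xe|/eqP xe]; first exact: reach0.
set i := (act x).1; have li := stn i.
have nq : (x, Go : phase) != sim_halt by rewrite xpair_eqE negb_and xe.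
case E: (act x) => [i' [a|]]; have ei : i' = i by rewrite /i E.
  apply: (@reach_le _ _ ((size (st i)).+1 + (size (st i)).+1).+1); first lia.
  apply: reachS; apply: reach_trans.
    apply: (@push_right x 0 a _ _ (st i)); last first.
      apply: tape_at_ext; first exact: (fset_id (cells (fun i => onth (st i))) 1).
      by apply: (step_stay hc nq) => /=; rewrite E.
    by move=> j; rewrite add0n.
  move=> c' hc'; rewrite add0n in hc'.
  apply: reach_imp; last first.
  - apply: return_left hc' => j jl; exists i; rewrite eqxx /= subn0.
    move: (st i) jl => s; elim: s a j {hc li E} => [|b s IH] a [|j] //= jl.
    exact: IH.
  - move=> c2 h2; rewrite ei.
    apply: tape_at_ext h2; apply: cells_ext => k j; rewrite /= subn0 ffunE andbT.
    by rewrite /i E; case: eqP.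
apply: (@reach_le _ _ ((size (st i)).+1 + (size (st i)).+1).+1); first lia.
apply: reachS; apply: reach_trans.
  apply: (@pop_right x 0 _ (fun i => onth (st i)) (st i)) => //.
  apply: tape_at_ext; first exact: (fset_id (cells (fun i => onth (st i))) 1).
  by apply: (step_stay hc nq) => /=; rewrite E.
move=> c' hc'; rewrite add0n in hc'.
apply: reach_imp; last first.
- apply: pop_left hc' => j; move: (st _) => s; elim: s j {hc li E} => [|b s IH] [|j] //= jl.
  exact: IH.
move=> c2 h2; rewrite ei /=.
have -> : ohead (st i) = if size (st i) is 0 then None else onth (st i) 0.
  by case: (st i).
apply: tape_at_ext h2; apply: cells_ext => k j; rewrite /= !ffunE.
have -> : (act x).1 = i by [].
case: eqP => [->|//] /=.
case: (st i) => [|b s] /=; first by rewrite onth0n.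
rewrite ltnS eqSS; case: ltngtP => [//|js|->]; last by rewrite onth_default.
by rewrite !onth_default //= ltnW.
Qed.
End Simulation.

(** * Stack programs *)

Definition stacks_size (st : stacks) := \sum_i size (st i).

Lemma size_stack (st : stacks) i : size (st i) <= stacks_size st.
Proof. by rewrite /stacks_size (bigD1 i) //= leq_addr. Qed.

Lemma stacks_size_upd (st : stacks) i s n : size s <= size (st i) + n ->
  stacks_size (upd st i s) <= stacks_size st + n.
Proof.
move=> le; rewrite /stacks_size (bigD1 i) //= [X in _ <= X + n](bigD1 i) //=.
rewrite ffunE eqxx addnAC leq_add //.
by apply: leq_sum => j /negbTE ne; rewrite ffunE ne.
Qed.

Definition input_stacks (x : seq sym) : stacks := upd [ffun=> [::]] track0 x.

Section SimulationRun.
Variables (X : finType) (exit : X).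
Variables (act : X -> reg * option sym) (nxt : X -> option sym -> X).
Notation srun := (sstep exit act nxt).
Notation step := (tm_step (sim_delta act nxt) (sim_halt exit)).

Lemma sstep_size x st : stacks_size (srun (x, st)).2 <= stacks_size st + 1.
Proof.
rewrite /sstep; case: eqP => _ /=; first by rewrite leq_addr.
case: (act x) => i [a|] /=; apply: stacks_size_upd; first by rewrite addn1.
by rewrite size_behead; lia.
Qed.

(** An operation lengthens the stacks by at most one symbol, so [stacks_size st + n] bounds every
    stack during [n] operations. *)
Lemma sim_run x st c n : simulates x st c ->
  reach step (n * (2 * (stacks_size st + n) + 4))
    (simulates (iter n srun (x, st)).1 (iter n srun (x, st)).2) c.
Proof.
elim: n => [|n IH] in x st c * => hc; first exact: reach0.
rewrite mulSn; apply: reach_trans.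
  apply: (@sim_step _ exit _ _ _ _ _ (stacks_size st + n.+1)) hc => i.
  by rewrite (leq_trans (size_stack _ i)) ?leq_addr.
move=> c' /IH; rewrite iterSr -surjective_pairing; apply: reach_le.
by rewrite leq_mul2l leq_add2r leq_mul2l; have := sstep_size x st; lia.
Qed.

Lemma cells_input x j :
  cells (fun i => onth (input_stacks x i)) j.+1 = omap inl (onth x j).
Proof.
rewrite /= /input_stacks.
have -> : [ffun i => onth (upd [ffun=> [::]] track0 x i) j] =
          if onth x j is Some a then cell_input a else [ffun=> None].
  apply/ffunP => i; rewrite !ffunE; case: eqP => [->|ne].
    by case: (onth x j) => [a|]; rewrite ffunE.
  by rewrite ?ffunE onth0n; case: (onth x j) => [a|]; rewrite ffunE //; case: eqP.
case: (onth x j) => [a|] /=; rewrite /cell_enc ?eqxx //.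
case: eqP => [/ffunP /(_ track0)|_]; first by rewrite !ffunE eqxx.
by have -> : cell_input a track0 = Some a; [rewrite ffunE | rewrite eqxx].
Qed.

Lemma simulates_init (x : X) s :
  simulates x (input_stacks s) 
    (@init_config cell (X * phase)%type (x, inl (inl None)) s).
Proof.
split; first by case: s.
  by case: s => [|a s] [|j].
move=> j; rewrite add1n cells_input.
case: s => [|a s]; first by case: j => [|[|j]].
case: j => [|j] //=; elim: s j => [|b s IH] [|j] //=; exact: IH.
Qed.

Lemma simulates_out (x : X) s c : simulates x (input_stacks s) c ->
  cst c = (x, inl (inl None)) /\ read_out (chead c :: cright c) = s.
Proof.
case=> -> _ hr; split=> //.
have {}hr j : nth None (chead c :: cright c) j = omap inl (onth s j).
  by rewrite hr add1n cells_input.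
elim: s (_ :: _) hr => [|a s IH] l hl.
  by case: l hl => [|b l] //= /(_ 0) /= ->.
case: l hl => [|b l] hl; first by have := hl 0.
have /= -> := hl 0; rewrite (IH l) // => j; exact: (hl j.+1).
Qed.
End SimulationRun.

(** The branches of [Case] and [Loop] are functions on the finite type [option sym], so a command
    has finitely many program points. [Loop] pops before testing, hence it also runs the branch of
    the symbol on which it stops. *)
Inductive cmd :=
| Skip
| Push of reg & sym
| Seq of cmd & cmd
| Case of reg & (option sym -> cmd)
| Loop of reg & (option sym -> bool) & (option sym -> cmd).

Definition pop (st : stacks) i := upd st i (behead (st i)).

(* The cost only bounds the number of stack operations, so that exec is monotone
   in it. *)
Inductive exec : cmd -> stacks -> stacks -> nat -> Prop :=
| ExecSkip st n : exec Skip st st n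
| ExecPush i a (st : stacks) n : exec (Push i a) st (upd st i (a :: st i)) n.+1
| ExecSeq c1 c2 st st1 st2 n1 n2 : exec c1 st st1 n1 -> exec c2 st1 st2 n2 ->
    exec (Seq c1 c2) st st2 (n1 + n2)
| ExecCase i k (st st' : stacks) n : exec (k (ohead (st i))) (pop st i) st' n ->
    exec (Case i k) st st' n.+1
| ExecLoop i (g : option sym -> bool) k (st st1 st2 : stacks) n1 n2 : g (ohead (st i)) ->
    exec (k (ohead (st i))) (pop st i) st1 n1 ->
    exec (Loop i g k) st1 st2 n2 -> exec (Loop i g k) st st2 (n1 + n2).+1
| ExecDone i (g : option sym -> bool) k (st st' : stacks) n : ~~ g (ohead (st i)) ->
    exec (k (ohead (st i))) (pop st i) st' n ->
    exec (Loop i g k) st st' n.+1.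

Lemma exec_le c st st' n m : n <= m -> exec c st st' n -> exec c st st' m.
Proof.
move=> + h; elim: h m => {c st st' n}.
- by move=> *; constructor.
- by move=> i a st n [//|m] _; constructor.
- move=> c1 c2 st st1 st2 n1 n2 h1 IH1 h2 IH2 m le.
  have -> : m = (m - n2) + n2 by lia.
  by apply: ExecSeq h2; apply: IH1; lia.
- by move=> i k st st' n h IH [//|m] le; apply: ExecCase (IH _ le).
- move=> i g k st st1 st2 n1 n2 gi h1 IH1 h2 IH2 [//|m] le.
  have -> : m = (m - n2) + n2 by lia.
  by apply: ExecLoop h2 => //; apply: IH1; lia.
- by move=> i g k st st' n gi h IH [//|m] le; apply: ExecDone (IH _ le).
Qed.

Lemma exec_size c st st' n : exec c st st' n ->
  stacks_size st' <= stacks_size st + n.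
Proof.
have pop_size (st0 : stacks) i : stacks_size (pop st0 i) <= stacks_size st0.
  rewrite -[leqRHS]addn0; apply: stacks_size_upd.
  by rewrite size_behead; lia.
elim=> {c st st' n} [st n|i a st n|c1 c2 st st1 st2 n1 n2 _ h1 _ h2|
  i k st st' n _ h|i g k st st1 st2 n1 n2 _ _ h1 _ h2|i g k st st' n _ _ h].
- by rewrite leq_addr.
- by apply: stacks_size_upd => /=; lia.
- lia.
- by have := pop_size st i; lia.
- by have := pop_size st i; lia.
- by have := pop_size st i; lia.
Qed.

(** In a [Case] or [Loop], [None] is the pop itself and [Some] a point of a branch, tagged with the
    symbol that selected it. Outside, [option (point c)] adds the end of the command as [None];
    [Skip] has no point and is at its end from the start. *)
Fixpoint point (c : cmd) : finType :=
  match c with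
  | Skip => void
  | Push _ _ => unit
  | Seq c1 c2 => (point c1 + point c2)%type
  | Case _ k | Loop _ _ k => option {o : option sym & point (k o)}
  end.

Definition branch k (o : option sym) (p : point (k o)) :
  option {o : option sym & point (k o)} := Some (Tagged (fun o => point (k o)) p).

Fixpoint entry (c : cmd) : option (point c) :=
  match c return option (point c) with
  | Skip => None
  | Push _ _ => Some tt
  | Seq c1 c2 => if entry c1 is Some p then Some (inl p) else omap inr (entry c2)
  | Case _ _ | Loop _ _ _ => Some None
  end.

Fixpoint pact (c : cmd) : point c -> reg * option sym :=
  match c return point c -> reg * option sym with
  | Skip => fun p => match p with end
  | Push i a => fun _ => (i, Some a)
  | Seq c1 c2 => fun p => match p with inl q => pact q | inr q => pact q end
  | Case i k => fun p => if p is Some q then pact (tagged q) else (i, None)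
  | Loop i g k => fun p => if p is Some q then pact (tagged q) else (i, None)
  end.

Fixpoint pnxt (c : cmd) : point c -> option sym -> option (point c) :=
  match c return point c -> option sym -> option (point c) with
  | Skip => fun p => match p with end
  | Push i a => fun _ _ => None
  | Seq c1 c2 => fun p o =>
      match p with
      | inl q => if pnxt q o is Some q' then Some (inl q') else omap inr (entry c2)
      | inr q => omap inr (pnxt q o)
      end
  | Case i k => fun p o =>
      match p with
      | None => omap (@branch k o) (entry (k o))
      | Some q => omap (@branch k (tag q)) (pnxt (tagged q) o)
      end
  | Loop i g k => fun p o =>
      match p with
      | None => if entry (k o) is Some q' then Some (branch q')
                else if g o then Some None else None
      | Some q => if pnxt (tagged q) o is Some q' then Some (branch q')
                  else if g (tag q) then Some None else None
      end
  end.

(** * Correctness of the compilation of commands *)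

Section Embedding.
Variables (X : finType) (exit : X).
Variables (act : X -> reg * option sym) (nxt : X -> option sym -> X).
Notation srun := (sstep exit act nxt).

Lemma sstep_push x i a st : x <> exit -> act x = (i, Some a) ->
  srun (x, st) = (nxt x None, upd st i (a :: st i)).
Proof. by rewrite /sstep => /eqP/negbTE -> ->. Qed.

Lemma sstep_pop x i st : x <> exit -> act x = (i, None) ->
  srun (x, st) = (nxt x (ohead (st i)), pop st i).
Proof. by rewrite /sstep => /eqP/negbTE -> ->. Qed.

(** [phi] places the points of [c], and its end, among the points of a surrounding program.
    Quantifying over all placements lets the induction on executions descend into subcommands, whose
    end is the start of what follows them. *)
Definition embeds (c : cmd) (phi : option (point c) -> X) : Prop :=
  forall p, [/\ phi (Some p) <> exit, act (phi (Some p)) = pact p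
    & forall o, nxt (phi (Some p)) o = phi (pnxt p o)].

Lemma embeds_seq1 c1 c2 (phi : option (point (Seq c1 c2)) -> X) :
  embeds phi ->
  embeds (fun o : option (point c1) => if o is Some p then phi (Some (inl p))
                   else phi (omap inr (entry c2))).
Proof.
move=> em p; have [ne ac nx] := em (inl p); split=> // o.
by rewrite nx /=; case: pnxt.
Qed.

Lemma embeds_seq2 c1 c2 (phi : option (point (Seq c1 c2)) -> X) :
  embeds phi -> embeds (fun o : option (point c2) => phi (omap inr o)).
Proof. by move=> em p; have [ne ac nx] := em (inr p). Qed.

Lemma embeds_case i k o (phi : option (point (Case i k)) -> X) :
  embeds phi -> embeds (fun p : option (point (k o)) => phi (omap (@branch k o) p)).
Proof. by move=> em p; have [ne ac nx] := em (branch p). Qed.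

(** A finished branch goes back to the loop or leaves it according to the symbol that selected it;
    for this the points of branches remember their symbol. *)
Lemma embeds_loop i g k o (phi : option (point (Loop i g k)) -> X) :
  embeds phi ->
  embeds (fun p : option (point (k o)) =>
            if p is Some q then phi (Some (branch q))
            else if g o then phi (Some None) else phi None).
Proof.
move=> em p; have [ne ac nx] := em (branch p); split=> // o'.
by rewrite nx /=; case: pnxt => //; case: (g o).
Qed.

Lemma exec_reach c st st' n (phi : option (point c) -> X) :
  embeds phi -> exec c st st' n ->
  reach srun n (eq (phi None, st')) (phi (entry c), st).
Proof.
move=> em h; elim: h phi em => {c st st' n}.
- by move=> st n phi em; apply: reach0.
- move=> i a st n phi em; have [ne ac nx] := em tt.
  by apply: reachS; apply: reach0; rewrite (sstep_push _ ne ac) nx.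
- move=> c1 c2 st st1 st2 n1 n2 _ IH1 _ IH2 phi em.
  apply: (@reach_trans _ _ n1 n2 (eq (phi (omap inr (entry c2)), st1))).
    have /= := IH1 _ (embeds_seq1 em).
    by case: (entry c1).
  by move=> _ <-; have := IH2 _ (embeds_seq2 em).
- move=> i k st st' n _ IH phi em; have [ne ac nx] := em None.
  apply: reachS; rewrite (sstep_pop _ ne ac) nx /=.
  exact: IH _ (embeds_case em).
- move=> i g k st st1 st2 n1 n2 gi _ IH1 _ IH2 phi em.
  have [ne ac nx] := em None.
  apply: reachS; rewrite (sstep_pop _ ne ac) nx /=.
  apply: (@reach_trans _ _ n1 n2 (eq (phi (Some None), st1))).
    have /= := IH1 _ (embeds_loop (o := ohead (st i)) em).
    by rewrite gi; case: (entry (k _)).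
  by move=> _ <-; have := IH2 _ em.
- move=> i g k st st' n /negbTE gi _ IH phi em.
  have [ne ac nx] := em None.
  apply: reachS; rewrite (sstep_pop _ ne ac) nx /=.
  have /= := IH _ (embeds_loop (o := ohead (st i)) em).
  by rewrite gi; case: (entry (k _)).
Qed.
End Embedding.

Theorem cmd_turing (c : cmd) :
  exists (W Q : finType) (delta : Q -> tsym W -> Q * tsym W * move) (q0 qf : Q),
  forall x y n, exec c (input_stacks x) (input_stacks y) n ->
  exists2 t, t <= n * (2 * (size x + n) + 4) &
    tm_runs delta qf q0 x t y.
Proof.
pose act (p : option (point c)) := if p is Some q then pact q else (track0, None).
pose nxt (p : option (point c)) o := if p is Some q then pnxt q o else None.
exists cell, (option (point c) * phase)%type, (sim_delta act nxt).
exists (entry c, inl (inl None)), (sim_halt None) => x y n ex.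
have em : @embeds _ None act nxt c id by [].
have [t tn et] := exec_reach em ex.
have := @sim_run _ None act nxt _ _ _ t (simulates_init (entry c) x).
rewrite -et /= => -[t' le /simulates_out []]; exists t'; last by split.
apply: leq_trans le _; apply: (leq_mul tn).
rewrite leq_add2r leq_mul2l; apply: (leq_add _ tn).
rewrite /stacks_size (bigD1 track0) //= ffunE eqxx big1 ?addn0 // => i ne.
by rewrite ffunE (negbTE ne) ffunE.
Qed.

(** * Stack programs on serialised binary trees *)

Inductive tree := Leaf | Node of tree & tree.

(** Prefix notation is self-delimiting, so trees can be stacked on one another without
    separators. *)
Fixpoint ser (t : tree) : seq sym :=
  if t is Node l r then SB :: ser l ++ ser r else [:: SA].
Definition tree_size (t : tree) := size (ser t).

Lemma tree_size_gt0 t : 0 < tree_size t.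
Proof. by case: t. Qed.

Lemma tree_size_node l r : tree_size (Node l r) = (tree_size l + tree_size r).+1.
Proof. by rewrite /tree_size /= size_cat. Qed.

Notation rT := track0.
Definition rA : reg := (false, true).
Definition rB : reg := (true, false).
Definition rC : reg := (true, true).

Definition St (t a b c : seq sym) : stacks :=
  [ffun i => match i with
             | (false, false) => t | (false, true) => a
             | (true, false) => b | (true, true) => c end].

Lemma StE t a b c : (St t a b c rT = t) * (St t a b c rA = a) *
  (St t a b c rB = b) * (St t a b c rC = c).
Proof. by rewrite !ffunE. Qed.

Lemma updE t a b c s :
  (upd (St t a b c) rT s = St s a b c) * (upd (St t a b c) rA s = St t s b c) *
  (upd (St t a b c) rB s = St t a s c) * (upd (St t a b c) rC s = St t a b s).
Proof. by do !split; apply/ffunP => -[[] []]; rewrite !ffunE. Qed.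

Lemma popE t a b c :
  (pop (St t a b c) rT = St (behead t) a b c) *
  (pop (St t a b c) rA = St t (behead a) b c) *
  (pop (St t a b c) rB = St t a (behead b) c) *
  (pop (St t a b c) rC = St t a b (behead c)).
Proof. by rewrite /pop !updE !StE. Qed.

Definition isSym (o : option sym) := o != None.

Definition pour s d : cmd :=
  Loop s isSym (fun o => if o is Some x then Push d x else Skip).
Definition pour2 s d d' : cmd :=
  Loop s isSym (fun o => if o is Some x then Seq (Push d x) (Push d' x) else Skip).
Definition clear s : cmd := Loop s isSym (fun _ => Skip).

(* Stack C counts the subtrees of the tree on top of stack T that remain to be
   moved. *)
Definition move_loop d : cmd :=
  Loop rC isSym (fun o =>
    if o is Some _ then
      Case rT (fun s => if s is Some SB
                        then Seq (Push d SB) (Seq (Push rC SA) (Push rC SA))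
                        else Push d SA)
    else Skip).
Definition move_tree d : cmd := Seq (Push rC SA) (move_loop d).

Lemma exec_push t a b c x :
  [/\ exec (Push rT x) (St t a b c) (St (x :: t) a b c) 1,
      exec (Push rA x) (St t a b c) (St t (x :: a) b c) 1,
      exec (Push rB x) (St t a b c) (St t a (x :: b) c) 1
    & exec (Push rC x) (St t a b c) (St t a b (x :: c)) 1].
Proof.
by split; [have := ExecPush rT x (St t a b c) 0 | have := ExecPush rA x (St t a b c) 0
  | have := ExecPush rB x (St t a b c) 0 | have := ExecPush rC x (St t a b c) 0];
  rewrite !updE !StE.
Qed.

Lemma push_T t a b c x : exec (Push rT x) (St t a b c) (St (x :: t) a b c) 1.
Proof. by have [] := exec_push t a b c x. Qed.
Lemma push_A t a b c x : exec (Push rA x) (St t a b c) (St t (x :: a) b c) 1.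
Proof. by have [] := exec_push t a b c x. Qed.
Lemma push_B t a b c x : exec (Push rB x) (St t a b c) (St t a (x :: b) c) 1.
Proof. by have [] := exec_push t a b c x. Qed.
Lemma push_C t a b c x : exec (Push rC x) (St t a b c) (St t a b (x :: c)) 1.
Proof. by have [] := exec_push t a b c x. Qed.

Lemma exec_caseT k t a b c st n :
  exec (k (ohead t)) (St (behead t) a b c) st n ->
  exec (Case rT k) (St t a b c) st n.+1.
Proof. by move=> h; apply: ExecCase; rewrite popE StE. Qed.


(** [e] selects the target of a move, [m] is its content and [o] that of the other buffer; one proof
    then covers both targets. *)
Definition rAB (e : bool) := if e then rA else rB.
Definition StAB (e : bool) t m o c := if e then St t m o c else St t o m c.

Lemma StAB_T e t m o c :
  (StAB e t m o c rT = t) * (pop (StAB e t m o c) rT = StAB e (behead t) m o c).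
Proof. by case: e; rewrite /= StE popE. Qed.

Lemma StAB_C e t m o c :
  (StAB e t m o c rC = c) * (pop (StAB e t m o c) rC = StAB e t m o (behead c)).
Proof. by case: e; rewrite /= StE popE. Qed.

Lemma push_AB e t m o c x :
  exec (Push (rAB e) x) (StAB e t m o c) (StAB e t (x :: m) o c) 1.
Proof. by case: e; [apply: push_A | apply: push_B]. Qed.

Lemma push_ABC e t m o c x :
  exec (Push rC x) (StAB e t m o c) (StAB e t m o (x :: c)) 1.
Proof. by case: e; apply: push_C. Qed.

(* Stated backwards from the end of the loop, so that the two subtrees of a
   node compose. *)
Lemma move_loopP e x r m o c st n :
  exec (move_loop (rAB e)) (StAB e r (rev (ser x) ++ m) o c) st n ->
  exec (move_loop (rAB e)) (StAB e (ser x ++ r) m o (SA :: c)) st (5 * tree_size x + n).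
Proof.
elim: x r m c n => [|x IHx y IHy] r m c n h.
  apply: (@ExecLoop _ _ _ _ (StAB e r (SA :: m) o c) _ 4 n) => //.
    by rewrite StAB_C.
  rewrite !StAB_C /=; apply: ExecCase; rewrite !StAB_T /=.
  exact: exec_le (push_AB _ _ _ _ _ _).
have -> : 5 * tree_size (Node x y) + n = (4 + (5 * tree_size x + (5 * tree_size y + n))).+1.
  by rewrite tree_size_node; lia.
apply: (@ExecLoop _ _ _ _
  (StAB e (ser x ++ ser y ++ r) (SB :: m) o (SA :: SA :: c))).
- by rewrite StAB_C.
- rewrite !StAB_C /=; apply: ExecCase; rewrite !StAB_T /= -catA.
  apply: (@ExecSeq _ _ _ (StAB e (ser x ++ ser y ++ r) (SB :: m) o c) _ 1 2).
    exact: push_AB.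
  apply: (@ExecSeq _ _ _ (StAB e (ser x ++ ser y ++ r) (SB :: m) o (SA :: c)) _ 1 1).
    exact: push_ABC.
  exact: push_ABC.
- apply: IHx; apply: IHy; move: h; rewrite /= rev_cons rev_cat cat_rcons.
  by rewrite -!catA.
Qed.

Lemma move_treeP e x r m o :
  exec (move_tree (rAB e)) (StAB e (ser x ++ r) m o [::])
    (StAB e r (rev (ser x) ++ m) o [::]) (5 * tree_size x + 2).
Proof.
have -> : 5 * tree_size x + 2 = 1 + (5 * tree_size x + 1) by lia.
apply: ExecSeq (push_ABC _ _ _ _ _ _) _; apply: move_loopP.
by apply: ExecDone; rewrite !StAB_C //; apply: ExecSkip.
Qed.

Lemma move_treeA x r m o :
  exec (move_tree rA) (St (ser x ++ r) m o [::])
    (St r (rev (ser x) ++ m) o [::]) (5 * tree_size x + 2).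
Proof. exact: (move_treeP true). Qed.

Lemma move_treeB x r m o :
  exec (move_tree rB) (St (ser x ++ r) o m [::])
    (St r o (rev (ser x) ++ m) [::]) (5 * tree_size x + 2).
Proof. exact: (move_treeP false). Qed.

Lemma pour_AT s t b c :
  exec (pour rA rT) (St t s b c) (St (catrev s t) [::] b c) (2 * size s + 1).
Proof.
elim: s t => [|x s IH] t.
  by apply: ExecDone; rewrite StE //= popE; apply: ExecSkip.
have -> : 2 * size (x :: s) + 1 = (1 + (2 * size s + 1)).+1 by rewrite /=; lia.
apply: ExecLoop; last exact: IH; rewrite StE //= popE; exact: push_T.
Qed.

Lemma pour_BT s t a c :
  exec (pour rB rT) (St t a s c) (St (catrev s t) a [::] c) (2 * size s + 1).
Proof.
elim: s t => [|x s IH] t.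
  by apply: ExecDone; rewrite StE //= popE; apply: ExecSkip.
have -> : 2 * size (x :: s) + 1 = (1 + (2 * size s + 1)).+1 by rewrite /=; lia.
apply: ExecLoop; last exact: IH; rewrite StE //= popE; exact: push_T.
Qed.

Lemma pour_BA s t a c :
  exec (pour rB rA) (St t a s c) (St t (catrev s a) [::] c) (2 * size s + 1).
Proof.
elim: s a => [|x s IH] a.
  by apply: ExecDone; rewrite StE //= popE; apply: ExecSkip.
have -> : 2 * size (x :: s) + 1 = (1 + (2 * size s + 1)).+1 by rewrite /=; lia.
apply: ExecLoop; last exact: IH; rewrite StE //= popE; exact: push_A.
Qed.

Lemma pour_TA s a b c :
  exec (pour rT rA) (St s a b c) (St [::] (catrev s a) b c) (2 * size s + 1).
Proof.
elim: s a => [|x s IH] a.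
  by apply: ExecDone; rewrite StE //= popE; apply: ExecSkip.
have -> : 2 * size (x :: s) + 1 = (1 + (2 * size s + 1)).+1 by rewrite /=; lia.
apply: ExecLoop; last exact: IH; rewrite StE //= popE; exact: push_A.
Qed.

Lemma pour2_ATB s t b c :
  exec (pour2 rA rT rB) (St t s b c) (St (catrev s t) [::] (catrev s b) c)
    (3 * size s + 1).
Proof.
elim: s t b => [|x s IH] t b.
  by apply: ExecDone; rewrite StE //= popE; apply: ExecSkip.
have -> : 3 * size (x :: s) + 1 = (2 + (3 * size s + 1)).+1 by rewrite /=; lia.
apply: ExecLoop; last exact: IH; rewrite StE //= popE.
exact: (@ExecSeq _ _ _ _ _ 1 1 (push_T _ _ _ _ _) (push_B _ _ _ _ _)).
Qed.

Lemma clear_A s t b c :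
  exec (clear rA) (St t s b c) (St t [::] b c) (size s + 1).
Proof.
elim: s => [|x s IH].
  by apply: ExecDone; rewrite ?StE //= popE; apply: ExecSkip.
by apply: (@ExecLoop _ _ _ _ _ _ 0 _ _ _ IH); rewrite ?StE //= popE; apply: ExecSkip.
Qed.

(** Every move or pour reverses the word. The second copy therefore travels through B and A before
    it reaches T in the right orientation. *)
Definition dup_cmd : cmd :=
  Seq (move_tree rA) (Seq (pour2 rA rT rB) (Seq (pour rB rA) (pour rA rT))).
Definition swap_cmd : cmd :=
  Seq (move_tree rA) (Seq (move_tree rB) (Seq (pour rA rT) (pour rB rT))).
Definition drop_cmd : cmd := Seq (move_tree rA) (clear rA).

Notation Stack t := (St t [::] [::] [::]).

Lemma size_rev_ser x : size (rev (ser x)) = tree_size x.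
Proof. by rewrite size_rev. Qed.

Lemma dupP x r : exec dup_cmd (Stack (ser x ++ r)) (Stack (ser x ++ ser x ++ r))
  (12 * tree_size x + 5).
Proof.
have -> : 12 * tree_size x + 5 = (5 * tree_size x + 2) + ((3 * tree_size x + 1) +
   ((2 * tree_size x + 1) + (2 * tree_size x + 1))) by lia.
apply: ExecSeq (move_treeA _ _ _ _) _; rewrite cats0.
apply: ExecSeq; first by rewrite -[in 3 * _]size_rev_ser; apply: pour2_ATB.
rewrite !catrevE revK cats0; apply: ExecSeq (pour_BA _ _ _ _) _.
by rewrite catrevE cats0 -size_rev_ser -{3}(revK (ser x)) -catrevE; apply: pour_AT.
Qed.

Lemma swapP x y r : exec swap_cmd (Stack (ser x ++ ser y ++ r))
  (Stack (ser y ++ ser x ++ r)) (7 * tree_size x + 7 * tree_size y + 6).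
Proof.
have -> : 7 * tree_size x + 7 * tree_size y + 6 = (5 * tree_size x + 2) + ((5 * tree_size y + 2) +
   ((2 * tree_size x + 1) + (2 * tree_size y + 1))) by lia.
apply: ExecSeq (move_treeA _ _ _ _) _; apply: ExecSeq (move_treeB _ _ _ _) _.
rewrite !cats0; apply: ExecSeq.
  by rewrite -[in 2 * _]size_rev_ser; apply: pour_AT.
rewrite -size_rev_ser -{2}(revK (ser y)) -catrevE catrevE revK; apply: pour_BT.
Qed.

Lemma dropP x r : exec drop_cmd (Stack (ser x ++ r)) (Stack r) (6 * tree_size x + 3).
Proof.
have -> : 6 * tree_size x + 3 = (5 * tree_size x + 2) + (tree_size x + 1) by lia.
apply: ExecSeq (move_treeA _ _ _ _) _; rewrite cats0 -size_rev_ser; exact: clear_A.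
Qed.

(** The arbitrary rest [r] of the stack lets a command run on top of saved data; the three auxiliary
    stacks are empty before and after. *)
Definition computes (c : cmd) (x y : tree) (n : nat) : Prop :=
  forall r, exec c (Stack (ser x ++ r)) (Stack (ser y ++ r)) n.

Lemma computes_le c x y n m : n <= m -> computes c x y n -> computes c x y m.
Proof. by move=> nm h r; apply: exec_le nm (h r). Qed.

(** At most [n] symbols are pushed by [n] operations. A time bound thus bounds the output, which is
    what makes compositions polynomial. *)
Lemma computes_size c x y n : computes c x y n -> tree_size y <= tree_size x + n.
Proof.
move=> /(_ [::]) /exec_size; rewrite !cats0.
have sz s : stacks_size (Stack s) = size s.
  rewrite /stacks_size (bigD1 rT) //= StE big1 ?addn0 // => -[[] []] //= _;
  by rewrite ffunE.
by rewrite !sz.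
Qed.

Lemma computes_id x : computes Skip x x 0.
Proof. by move=> r; apply: ExecSkip. Qed.

Lemma computes_comp c d x y z n m :
  computes c x y n -> computes d y z m -> computes (Seq c d) x z (n + m).
Proof. by move=> hc hd r; apply: ExecSeq (hc r) (hd r). Qed.

Definition pair_cmd c d : cmd :=
  Seq dup_cmd (Seq d (Seq swap_cmd (Seq c (Push rT SB)))).

(** The factor 8 of [m] is one for running [d] and seven for swapping its output, which has size at
    most [tree_size x + m]. *)
Lemma computes_pair c d x y z n m :
  computes c x y n -> computes d x z m ->
  computes (pair_cmd c d) x (Node y z) (n + 8 * m + 26 * tree_size x + 12).
Proof.
move=> hc hd r; have zm := computes_size hd.
apply: (@exec_le _ _ _ ((12 * tree_size x + 5) + (m + ((7 * tree_size z + 7 * tree_size x + 6) +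
   (n + 1))))); first by lia.
apply: ExecSeq (dupP _ _) _; apply: ExecSeq (hd _) _.
apply: ExecSeq (swapP _ _ _) _; apply: ExecSeq (hc _) _.
by rewrite /= -catA; apply: push_T.
Qed.

Definition fst_cmd : cmd := Case rT (fun _ => Seq swap_cmd drop_cmd).

Lemma computes_fst x y : computes fst_cmd (Node x y) x (13 * tree_size (Node x y)).
Proof.
move=> r; have x0 := tree_size_gt0 x; have y0 := tree_size_gt0 y.
apply: (@exec_le _ _ _ ((7 * tree_size x + 7 * tree_size y + 6) + (6 * tree_size y + 3)).+1).
  by rewrite tree_size_node; lia.
apply: exec_caseT; rewrite /= -catA; exact: ExecSeq (swapP _ _ _) (dropP _ _).
Qed.

Definition snd_cmd : cmd := Case rT (fun _ => drop_cmd).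

Lemma computes_snd x y : computes snd_cmd (Node x y) y (13 * tree_size (Node x y)).
Proof.
move=> r; apply: (@exec_le _ _ _ (6 * tree_size x + 3).+1).
  by rewrite tree_size_node; lia.
by apply: exec_caseT; rewrite /= -catA; apply: dropP.
Qed.

Fixpoint push_seq (s : seq sym) : cmd :=
  if s is a :: s' then Seq (push_seq s') (Push rT a) else Skip.

Lemma push_seqP s r a b c :
  exec (push_seq s) (St r a b c) (St (s ++ r) a b c) (size s).
Proof.
elim: s => [|x s IH] /=; first exact: ExecSkip.
by rewrite -addn1; apply: ExecSeq IH (push_T _ _ _ _ _).
Qed.

Lemma computes_const y x :
  computes (Seq drop_cmd (push_seq (ser y))) x y (6 * tree_size x + 3 + tree_size y).
Proof. by move=> r; apply: ExecSeq (dropP _ _) (push_seqP _ _ _ _ _). Qed.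

(** The test runs on a copy of the argument, and every result other than [Leaf] counts as true.
    [Leaf] is a single symbol and vanishes with the pop; otherwise the popped [SB] is restored so
    that [drop_cmd] meets a whole tree. *)
Definition if_cmd t c d : cmd :=
  Seq dup_cmd (Seq t (Case rT (fun o =>
    if o is Some SB then Seq (Push rT SB) (Seq drop_cmd c) else d))).

Lemma computes_if t c d x b y n m :
  computes t x b n -> (if b is Leaf then computes d x y m else computes c x y m) ->
  computes (if_cmd t c d) x y (7 * n + m + 18 * tree_size x + 10).
Proof.
move=> ht hcd r; have bn := computes_size ht.
apply: (@exec_le _ _ _ ((12 * tree_size x + 5) + (n + (1 + ((6 * tree_size b + 3) + m)).+1))).
  by lia.
apply: ExecSeq (dupP _ _) _; apply: ExecSeq (ht _) _; apply: exec_caseT.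
case: b hcd {ht bn} => [|u v] h /=; first by apply: exec_le (h r); lia.
by apply: ExecSeq (push_T _ _ _ _ _) _; apply: ExecSeq (dropP (Node u v) _) (h r).
Qed.

(** [while_cmd] removes the outer node of the pair of list and accumulator, so that the top symbol
    tells whether the list is empty. Each round restores the popped node of the list and the outer
    node, runs the body on the pair and removes the outer node again. *)
Definition while_loop c : cmd :=
  Loop rT (fun o => o == Some SB)
    (fun o => if o is Some SB
              then Seq (Push rT SB) (Seq (Push rT SB) (Seq c (Case rT (fun _ => Skip))))
              else Skip).
Definition while_cmd c : cmd := Case rT (fun _ => while_loop c).

Lemma while_done c acc r :
  exec (while_loop c) (Stack (ser Leaf ++ ser acc ++ r)) (Stack (ser acc ++ r)) 1.
Proof. by apply: ExecDone; rewrite StE //= popE; apply: ExecSkip. Qed.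

Lemma while_next c h t acc t' acc' r st n m :
  computes c (Node (Node h t) acc) (Node t' acc') n ->
  exec (while_loop c) (Stack (ser t' ++ ser acc' ++ r)) st m ->
  exec (while_loop c) (Stack (ser (Node h t) ++ ser acc ++ r)) st (n + m + 4).
Proof.
move=> hc hw; have -> : n + m + 4 = ((1 + (1 + (n + 1))) + m).+1 by lia.
apply: ExecLoop hw; rewrite StE //= popE /=.
apply: ExecSeq (push_T _ _ _ _ _) _; apply: ExecSeq (push_T _ _ _ _ _) _.
have := hc r; rewrite [ser (Node (Node h t) acc)]/= [ser (Node t' acc')]/= !cat_cons -!catA => {}hc.
apply: ExecSeq hc _; apply: exec_caseT; exact: ExecSkip.
Qed.

(** * Polynomial-time functions *)

Structure codedType := Coded { coded_sort :> Type; encode : coded_sort -> tree }.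
Arguments encode {_} _.

(** Unary, like the numbers of the input word. The code of [n] is also that of [nseq n tt], which
    reduces arithmetic to lists, and [false] is coded by [Leaf], as [if_cmd] expects. *)
Definition nat_tree (n : nat) : tree := iter n (Node Leaf) Leaf.
Definition sym_nat (a : sym) : nat :=
  match a with SA => 0 | SB => 1 | SL => 2 | SR => 3 end.
Canonical coded_unit := @Coded unit (fun _ => Leaf).
Canonical coded_nat := @Coded nat nat_tree.
Canonical coded_bool := @Coded bool (fun b => nat_tree b).
Canonical coded_sym := @Coded sym (fun a => nat_tree (sym_nat a)).

Section CodedPairSeq.
Variables A B : codedType.
Canonical coded_prod :=
  @Coded (A * B) (fun p => Node (encode p.1) (encode p.2)).
Fixpoint encode_seq (s : seq A) : tree :=
  if s is x :: s' then Node (encode x) (encode_seq s') else Leaf.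
Canonical coded_seq := @Coded (seq A) encode_seq.
End CodedPairSeq.

Definition esize {A : codedType} (a : A) : nat := tree_size (encode a).

Section Esize.
Context {A B : codedType}.

Lemma esize_gt0 (a : A) : 0 < esize a.
Proof. exact: tree_size_gt0. Qed.

Lemma esize_pair (p : A * B) : esize p = (esize p.1 + esize p.2).+1.
Proof. exact: tree_size_node. Qed.

Lemma esize_nil : esize (Nil A) = 1. Proof. by []. Qed.

Lemma esize_cons (x : A) s : esize (x :: s) = (esize x + esize s).+1.
Proof. exact: tree_size_node. Qed.

Lemma esize_cat (s t : seq A) : esize (s ++ t) + 1 = esize s + esize t.
Proof.
elim: s => [|x s IH]; first by rewrite esize_nil addnC.
by rewrite cat_cons !esize_cons; lia.
Qed.

Lemma size_esize (s : seq A) : size s < esize s.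
Proof. by elim: s => //= x s IH; rewrite esize_cons; have := esize_gt0 x; lia. Qed.

(** Membership is expressed by splitting the list, since a coded type carries no decidable
    equality. *)
Lemma esize_seq_le (s : seq A) n : (forall x1 y x2, s = x1 ++ y :: x2 -> esize y <= n) ->
  esize s <= size s * n.+1 + 1.
Proof.
elim: s => // y s IH h; rewrite esize_cons /=.
have := h [::] y s erefl; have := IH (fun x1 z x2 e => h (y :: x1) z x2 (congr1 (cons y) e)).
lia.
Qed.
End Esize.

Lemma esize_mid (A : codedType) (x : A) s t : esize x < esize (s ++ x :: t).
Proof.
by have := esize_cat s (x :: t); rewrite esize_cons; have := esize_gt0 s;
  have := esize_gt0 t; lia.
Qed.

Lemma esize_nat (n : nat) : esize n = n.*2.+1.
Proof.
elim: n => // n IH; have -> : esize n.+1 = (1 + esize n).+1 by exact: tree_size_node.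
by rewrite IH doubleS.
Qed.

Lemma esize_sym (a : sym) : esize a <= 7.
Proof. by rewrite -[esize a]/(esize (sym_nat a)) esize_nat; case: a. Qed.

Section PBound.
Context {A : codedType}.

(** Codes have positive size, so a single monomial also absorbs constants and lower powers. *)
Definition pbound (g : A -> nat) : Prop :=
  exists c k, forall a, g a <= c * esize a ^ k.

Lemma pbound_le (g h : A -> nat) : (forall a, g a <= h a) -> pbound h -> pbound g.
Proof. by move=> gh [c [k hk]]; exists c, k => a; apply: leq_trans (gh a) _. Qed.

Lemma pbound_const n : pbound (fun _ => n).
Proof. by exists n, 0 => a; rewrite muln1. Qed.

Lemma pbound_esize : pbound (@esize A).
Proof. by exists 1, 1 => a; rewrite expn1 mul1n. Qed.

Lemma pbound_add g h : pbound g -> pbound h -> pbound (fun a => g a + h a).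
Proof.
case=> c [k gk] [d [l hl]]; exists (c + d), (k + l) => a.
rewrite mulnDl leq_add // (leq_trans (gk a) _, leq_trans (hl a) _) // leq_mul2l
  leq_pexp2l ?esize_gt0 ?orbT ?leq_addr ?leq_addl //.
Qed.

Lemma pbound_mul g h : pbound g -> pbound h -> pbound (fun a => g a * h a).
Proof.
case=> c [k gk] [d [l hl]]; exists (c * d), (k + l) => a.
by rewrite expnD mulnACA leq_mul.
Qed.

Lemma pbound_exp g k : pbound g -> pbound (fun a => g a ^ k).
Proof.
move=> hg; elim: k => [|k IH]; first exact: pbound_const.
by apply: pbound_le (pbound_mul hg IH) => a; rewrite expnS.
Qed.
End PBound.

Lemma pbound_comp (A B : codedType) (f : A -> B) (g : B -> nat) :
  pbound (fun a => esize (f a)) -> pbound g -> pbound (fun a => g (f a)).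
Proof.
move=> hf [c [k gk]]; apply: pbound_le (fun a => gk (f a)) _.
by apply: pbound_mul (pbound_const _) (pbound_exp _ _).
Qed.

Definition ptime {A B : codedType} (f : A -> B) : Prop :=
  exists (c : cmd) (g : A -> nat), pbound g /\
    forall a, computes c (encode a) (encode (f a)) (g a).

Section Ptime.
Context {A B : codedType}.

Lemma ptime_size (f : A -> B) : ptime f -> pbound (fun a => esize (f a)).
Proof.
case=> c [g [hg h]]; apply: pbound_le (pbound_add pbound_esize hg) => a.
exact: computes_size (h a).
Qed.

Lemma ptime_ext (f g : A -> B) : f =1 g -> ptime f -> ptime g.
Proof. by move=> fg [c [b [hb h]]]; exists c, b; split=> // a; rewrite -fg. Qed.

(** A change of type that leaves the code as it is costs nothing. *)
Lemma ptime_recode (f : A -> B) : (forall a, encode (f a) = encode a) -> ptime f.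
Proof.
move=> h; exists Skip, (fun=> 0); split; first exact: pbound_const.
by move=> a; rewrite h; apply: computes_id.
Qed.

End Ptime.

Section PtimeComp.
Context {A B C : codedType}.

Lemma ptime_comp (f : A -> B) (g : B -> C) : ptime f -> ptime g ->
  ptime (fun a => g (f a)).
Proof.
move=> hf [d [n [hn hd]]]; have sf := ptime_size hf; case: hf => c [m [hm hc]].
exists (Seq c d), (fun a => m a + n (f a)); split.
  by apply: pbound_add => //; apply: pbound_comp.
by move=> a; apply: computes_comp.
Qed.

End PtimeComp.

Section PtimePair.
Context {A B C : codedType}.

Lemma ptime_id : ptime (fun a : A => a).
Proof. exact: ptime_recode. Qed.

Lemma ptime_const (b : B) : ptime (fun _ : A => b).
Proof.
eexists _, _; split; last by move=> a; apply: computes_const.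
by do ![exact: pbound_const | exact: pbound_esize | apply: pbound_add | apply: pbound_mul].
Qed.

Lemma ptime_pair (f : A -> B) (g : A -> C) : ptime f -> ptime g ->
  ptime (fun a => (f a, g a)).
Proof.
case=> c [m [hm hc]] [d [n [hn hd]]].
eexists _, _; split; last by move=> a; apply: (computes_pair (hc a) (hd a)).
by do ![exact: hm | exact: hn | exact: pbound_const | exact: pbound_esize |
  apply: pbound_add | apply: pbound_mul].
Qed.

End PtimePair.

Section PtimeProj.
Context {A B C : codedType}.

Lemma ptime_fst (f : A -> B * C) : ptime f -> ptime (fun a => (f a).1).
Proof.
move=> hf; have sf := ptime_size hf; case: hf => c [m [hm hc]].
eexists _, _; split.
  2: by move=> a; apply: computes_comp (hc a) (computes_fst _ _).
apply: pbound_add hm _; exact: pbound_mul (pbound_const _) sf.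
Qed.

Lemma ptime_snd (f : A -> B * C) : ptime f -> ptime (fun a => (f a).2).
Proof.
move=> hf; have sf := ptime_size hf; case: hf => c [m [hm hc]].
eexists _, _; split.
  2: by move=> a; apply: computes_comp (hc a) (computes_snd _ _).
apply: pbound_add hm _; exact: pbound_mul (pbound_const _) sf.
Qed.

End PtimeProj.

Section PtimeList.
Context {A B C : codedType}.

(** A nonempty list has the same code as the pair of its head and tail. *)
Lemma ptime_cons (f : A -> B) (g : A -> seq B) : ptime f -> ptime g ->
  ptime (fun a => f a :: g a).
Proof.
move=> hf hg; have [c [m [hm hc]]] := ptime_pair hf hg.
by exists c, m; split.
Qed.

Lemma ptime_if (b : A -> bool) (f g : A -> B) : ptime b -> ptime f -> ptime g ->
  ptime (fun a => if b a then f a else g a).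
Proof.
case=> t [l [hl ht]] [c [m [hm hc]]] [d [n [hn hd]]].
eexists _, (fun a => 7 * l a + (m a + n a) + 18 * esize a + 10); split.
  by do ![exact: hm | exact: hn | exact: hl | exact: pbound_const |
    exact: pbound_esize | apply: pbound_add | apply: pbound_mul].
move=> a; apply: computes_if (ht a) _; rewrite {1}/encode; case: (b a) => /=.
  exact: computes_le (leq_addr _ _) (hc a).
exact: computes_le (leq_addl _ _) (hd a).
Qed.

Lemma ptime_case (l : A -> seq B) (f : A -> C) (g : A * B * seq B -> C) :
  ptime l -> ptime f -> ptime g ->
  ptime (fun a => if l a is h :: t then g ((a, h), t) else f a).
Proof.
move=> hl; have sl := ptime_size hl; case: hl => t [u [hu ht]].
move=> [c [m [hm hc]]] [d [n [[c1 [k hn]] hd]]].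
set N := fun a : A => esize a + esize (l a) + 1.
have hN : pbound N.
  by rewrite /N; do ![exact: sl | exact: pbound_const | exact: pbound_esize |
    apply: pbound_add].
pose e := Seq (pair_cmd (pair_cmd Skip (Seq t fst_cmd)) (Seq t snd_cmd)) d.
(* The list is computed three times: for the test, for the head and for the tail. The generous
   constant 300 absorbs all pairings and projections. *)
eexists _, (fun a => 7 * u a +
  (m a + (300 * (u a + esize a + esize (l a) + 1) + c1 * N a ^ k)) + 18 * esize a + 10).
split.
  by do ![exact: hm | exact: hu | exact: hN | exact: sl | exact: pbound_const |
    exact: pbound_esize | apply: pbound_add | apply: pbound_mul | apply: pbound_exp].
move=> a; apply: (computes_if (c := e) (ht a)); have := ht a.
rewrite /esize; case la: (l a) => [|x s] hta.
  exact: computes_le (leq_addr _ _) (hc a).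
rewrite {1}[encode (x :: s)]/=.
have h1 : computes (Seq t fst_cmd) (encode a) (encode x) _ :=
  computes_comp hta (computes_fst _ _).
have h2 : computes (Seq t snd_cmd) (encode a) (encode s) _ :=
  computes_comp hta (computes_snd _ _).
have h3 := computes_comp (computes_pair (computes_pair (computes_id _) h1) h2)
  (hd ((a, x), s)).
apply: computes_le h3; have := hn ((a, x), s).
have -> : esize (a, x, s) = N a.
  by rewrite /N la !esize_pair esize_cons /=; lia.
rewrite -/(esize a) -/(esize (x :: s)) -/(encode (x :: s)) -/(encode s).
lia.
Qed.
End PtimeList.

(** * Folds with bounded intermediate results *)

Section Foldl.
Context {A B C : codedType}.

Lemma while_foldl c (x : A) (f : C -> B -> C) (l : seq B) (a : C) r N :
  (forall l1 h t, l = l1 ++ h :: t ->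
    computes c (encode ((h, t), (x, foldl f a l1)))
      (encode (t, (x, f (foldl f a l1) h))) N) ->
  exec (while_loop c) (Stack (ser (encode l) ++ ser (encode (x, a)) ++ r))
    (Stack (ser (encode (x, foldl f a l)) ++ r)) (size l * (N + 4) + 1).
Proof.
elim: l a => [|h t IH] a hc; first exact: while_done.
have -> : size (h :: t) * (N + 4) + 1 = N + (size t * (N + 4) + 1) + 4.
  by rewrite /=; lia.
apply: while_next (hc [::] h t erefl) _.
by apply: IH => l1 h' t' e; apply: (hc (h :: l1)); rewrite e.
Qed.

(** [q] has to bound the accumulator after every prefix of the list: only then is one polynomial
    bound on the body valid in all rounds. The parameter [x] is carried along beside the
    accumulator. *)
Lemma ptime_foldl (f : A -> C -> B -> C) (l : A -> seq B) (a : A -> C) (q : A -> nat) :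
  ptime (fun p : A * C * B => f p.1.1 p.1.2 p.2) -> ptime l -> ptime a -> pbound q ->
  (forall x l1 l2, l x = l1 ++ l2 -> esize (foldl (f x) (a x) l1) <= q x) ->
  ptime (fun x => foldl (f x) (a x) (l x)).
Proof.
move=> hf hl ha hq hb.
pose body (p : (B * seq B) * (A * C)) := (p.1.2, (p.2.1, f p.2.1 p.2.2 p.1.1)).
have [c [g [[c1 [k hg]] hc]]] : ptime body.
  rewrite /body; apply: ptime_pair; first by apply: ptime_snd; apply: ptime_fst; exact: ptime_id.
  apply: ptime_pair; first by apply: ptime_fst; apply: ptime_snd; exact: ptime_id.
  apply: (ptime_comp (f := fun p : (B * seq B) * (A * C) => ((p.2.1, p.2.2), p.1.1)) _ hf).
  apply: ptime_pair; first apply: ptime_pair.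
  - by apply: ptime_fst; apply: ptime_snd; exact: ptime_id.
  - by apply: ptime_snd; apply: ptime_snd; exact: ptime_id.
  - by apply: ptime_fst; apply: ptime_fst; exact: ptime_id.
have sl := ptime_size hl; have sa := ptime_size ha.
have [d [n [hn hd]]] : ptime (fun x => (l x, (x, a x))).
  by do ![exact: hl | exact: ha | exact: ptime_id | apply: ptime_pair].
set N := fun x : A => c1 * (esize (l x) + esize x + q x + 3) ^ k.
enough (h : ptime (fun x => (x, foldl (f x) (a x) (l x)))) by exact: (ptime_snd h).
exists (Seq d (while_cmd c)), (fun x => n x + (esize (l x) * (N x + 4) + 1).+1).
split.
  apply: pbound_add hn _.
  apply: (@pbound_le _ _ (fun x => esize (l x) * (N x + 4) + 2)).
    by move=> x; rewrite addn2 addn1.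
  by rewrite /N; do ![exact: sl | exact: hq | exact: pbound_const |
    exact: pbound_esize | apply: pbound_add | apply: pbound_mul | apply: pbound_exp].
move=> x r; apply: ExecSeq (hd x r) _.
have -> : ser (encode (l x, (x, a x))) ++ r =
    SB :: ser (encode (l x)) ++ ser (encode (x, a x)) ++ r by rewrite catA.
apply: exec_caseT; rewrite [behead _]/=.
apply: exec_le (while_foldl (N := N x) _ _).
  by rewrite leq_add2r leq_mul2r ltnW ?orbT // size_esize.
move=> l1 h t e; apply: computes_le (hc ((h, t), (x, foldl (f x) (a x) l1))).
apply: leq_trans (hg _) _; rewrite leq_mul2l; apply/orP; right.
enough (le : esize ((h, t), (x, foldl (f x) (a x) l1)) <= esize (l x) + esize x + q x + 3).
  by case: (k) => // k'; rewrite leq_exp2r.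
have := esize_cat l1 (h :: t); rewrite !esize_pair /= -e. rewrite esize_cons.
by have := hb x l1 (h :: t) e; have := esize_gt0 l1; lia.
Qed.
End Foldl.

Section BinaryComp.
Context {A B C D : codedType}.

Lemma ptime_comp2 (g : B -> C -> D) (f1 : A -> B) (f2 : A -> C) :
  ptime (fun p : B * C => g p.1 p.2) -> ptime f1 -> ptime f2 ->
  ptime (fun a => g (f1 a) (f2 a)).
Proof.
move=> hg h1 h2.
exact: (ptime_comp (f := fun a => (f1 a, f2 a)) (ptime_pair h1 h2) hg).
Qed.

End BinaryComp.

Ltac pb := do ?[assumption | exact: pbound_const | exact: pbound_esize |
  apply: pbound_add | apply: pbound_mul | apply: pbound_exp | apply: ptime_size].

Section PtimeBool.
Context {A : codedType}.
Implicit Types b c : A -> bool.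

Lemma ptime_neg b : ptime b -> ptime (fun a => ~~ b a).
Proof.
move=> hb; apply: (ptime_ext (f := fun a => if b a then false else true)).
  by move=> a; case: (b a).
by apply: ptime_if => //; apply: ptime_const.
Qed.

Lemma ptime_and b c : ptime b -> ptime c -> ptime (fun a => b a && c a).
Proof. by move=> hb hc; apply: ptime_if => //; apply: ptime_const. Qed.

Lemma ptime_or b c : ptime b -> ptime c -> ptime (fun a => b a || c a).
Proof. by move=> hb hc; apply: ptime_if => //; apply: ptime_const. Qed.

Lemma ptime_eqb b c : ptime b -> ptime c -> ptime (fun a => b a == c a).
Proof.
move=> hb hc; apply: (ptime_ext (f := fun a => if b a then c a else ~~ c a)).
  by move=> a; case: (b a); case: (c a).
by apply: ptime_if => //; apply: ptime_neg.
Qed.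
End PtimeBool.

Section PtimeSeq.
Context {A B : codedType}.

Lemma ptime_head d (l : A -> seq B) : ptime d -> ptime l ->
  ptime (fun a => head (d a) (l a)).
Proof.
move=> hd hl; have hg : ptime (fun p : A * B * seq B => p.1.2).
  by apply: ptime_snd; apply: ptime_fst; apply: ptime_id.
exact: (ptime_case hl hd hg).
Qed.

Lemma ptime_behead (l : A -> seq B) : ptime l -> ptime (fun a => behead (l a)).
Proof.
move=> hl; have hg : ptime (fun p : A * B * seq B => p.2).
  by apply: ptime_snd; apply: ptime_id.
exact: (ptime_case hl (ptime_const (Nil B)) hg).
Qed.

Lemma ptime_null (l : A -> seq B) : ptime l -> ptime (fun a => nilp (l a)).
Proof.
move=> hl; have hg : ptime (fun p : A * B * seq B => false) by apply: ptime_const.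
apply: ptime_ext (ptime_case hl (ptime_const true) hg) => a.
by case: (l a).
Qed.

Lemma esize_rev (s : seq B) : esize (rev s) = esize s.
Proof.
elim: s => // x l IH; rewrite rev_cons -cats1 esize_cons -IH.
by have := esize_cat (rev l) [:: x]; rewrite esize_cons esize_nil; lia.
Qed.

Lemma ptime_catrev (s t : A -> seq B) : ptime s -> ptime t ->
  ptime (fun a => catrev (s a) (t a)).
Proof.
move=> hs ht.
have e (l m : seq B) : catrev l m = foldl (fun acc b => b :: acc) m l.
  by elim: l m => //= x l IH m; rewrite IH.
apply: ptime_ext (fun a => esym (e _ _)) _.
apply: (ptime_foldl (f := fun a acc b => b :: acc)
  (q := fun a => esize (s a) + esize (t a))) => //.
- by apply: ptime_cons; do ?[exact: ptime_id | apply: ptime_fst | apply: ptime_snd].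
- by pb.
move=> a l1 l2 el; rewrite -e el catrevE.
have := esize_cat (rev l1) (t a); have := esize_cat l1 l2.
by rewrite esize_rev; have := esize_gt0 l2; lia.
Qed.

Lemma ptime_rev (s : A -> seq B) : ptime s -> ptime (fun a => rev (s a)).
Proof. by move=> hs; apply: ptime_catrev => //; apply: ptime_const. Qed.
End PtimeSeq.

Section PtimeMap.
Context {A B C : codedType}.

Lemma esize_filter p (s : seq B) : esize (filter p s) <= esize s.
Proof.
elim: s => //= x s IH; case: (p x); rewrite !esize_cons; first by lia.
by rewrite (leq_trans IH) // leqW // leq_addl.
Qed.

Lemma ptime_cat (s t : A -> seq B) : ptime s -> ptime t ->
  ptime (fun a => s a ++ t a).
Proof.
move=> hs ht; apply: (ptime_ext (f := fun a => catrev (rev (s a)) (t a))).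
  by move=> a; rewrite catrevE revK.
by apply: ptime_catrev => //; apply: ptime_rev.
Qed.

Lemma ptime_map (f : A -> B -> C) (l : A -> seq B) :
  ptime (fun p : A * B => f p.1 p.2) -> ptime l ->
  ptime (fun a => map (f a) (l a)).
Proof.
move=> hf hl.
have e (g : B -> C) (s : seq B) : rev (foldl (fun acc b => g b :: acc) [::] s) = map g s.
  suff H m : foldl (fun acc b => g b :: acc) m s = catrev (map g s) m.
    by rewrite H catrevE cats0 revK.
  by elim: s m => //= x s IH m; rewrite IH.
apply: ptime_ext (fun a => e _ _) _; apply: ptime_rev.
have [c [k hk]] := ptime_size hf.
apply: (ptime_foldl (f := fun a acc b => f a b :: acc) (a := fun=> [::])
  (q := fun a => esize (l a) * (c * (esize a + esize (l a) + 1) ^ k).+1 + 1)) => //.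
- apply: ptime_cons; last by apply: ptime_snd; apply: ptime_fst; exact: ptime_id.
  apply: ptime_comp2 hf _ _; first by do 2!apply: ptime_fst; exact: ptime_id.
  by apply: ptime_snd; exact: ptime_id.
- exact: ptime_const.
- apply: (@pbound_le _ _ (fun a => esize (l a) *
    (c * (esize a + esize (l a) + 1) ^ k + 1) + 1)); last by pb.
  by move=> a; rewrite leq_add2r leq_mul2l [X in _ <= X]addn1 leqnn orbT.
move=> a l1 l2 el; rewrite -esize_rev e.
have sl := esize_cat l1 l2; have l2p := esize_gt0 l2.
apply: leq_trans (esize_seq_le (n := c * (esize a + esize (l a) + 1) ^ k) _) _.
  (* An element of the mapped list is located by its position, which yields its preimage [z] without
     any equality test. *)
  move=> x1 y x2 /(congr1 (fun s => take 1 (drop (size x1) s))).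
  rewrite -map_drop -map_take (drop_size_cat _ erefl) /= take0.
  case e2: (drop _ _) => [|z l3] // [<- _]; apply: leq_trans (hk (a, z)) _.
  have ez : esize z < esize l1.
    by rewrite -(cat_take_drop (size x1) l1) e2; apply: esize_mid.
  rewrite leq_mul2l; apply/orP; right.
  have : esize (a, z) <= esize a + esize (l a) + 1 by rewrite esize_pair el /=; lia.
  by case: (k) => // k' ?; rewrite leq_exp2r.
rewrite size_map leq_add2r leq_mul2r; have := size_esize l1; rewrite el; lia.
Qed.

End PtimeMap.

Ltac pvar := do ?[exact: ptime_id | apply: ptime_fst | apply: ptime_snd].

Lemma ptime_nseq_unit (A : codedType) (n : A -> nat) :
  ptime n -> ptime (fun a => nseq (n a) tt).
Proof.
move=> hn; apply: (ptime_comp hn (ptime_recode (f := fun m => nseq m tt) _)).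
by elim=> //= m ->.
Qed.

Section PtimeIterators.
Context {A B C : codedType}.

Lemma ptime_filter (p : A -> B -> bool) (l : A -> seq B) :
  ptime (fun q : A * B => p q.1 q.2) -> ptime l ->
  ptime (fun a => filter (p a) (l a)).
Proof.
move=> hp hl.
have e (g : B -> bool) (s : seq B) :
    rev (foldl (fun acc b => if g b then b :: acc else acc) [::] s) = filter g s.
  suff H m : foldl (fun acc b => if g b then b :: acc else acc) m s = catrev (filter g s) m.
    by rewrite H catrevE cats0 revK.
  by elim: s m => //= x s IH m; rewrite IH; case: (g x).
apply: ptime_ext (fun a => e _ _) _; apply: ptime_rev.
apply: (ptime_foldl (f := fun a acc b => if p a b then b :: acc else acc)
  (a := fun=> [::]) (q := fun a => esize (l a))) => //.
- apply: ptime_if; [|apply: ptime_cons|]; pvar.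
  by apply: (ptime_comp2 hp); pvar.
- exact: ptime_const.
- exact: ptime_size.
move=> a l1 l2 el; rewrite -esize_rev e; apply: leq_trans (esize_filter _ _) _.
by have := esize_cat l1 l2; rewrite el; have := esize_gt0 l2; lia.
Qed.

Lemma ptime_has (p : A -> B -> bool) (l : A -> seq B) :
  ptime (fun q : A * B => p q.1 q.2) -> ptime l ->
  ptime (fun a => has (p a) (l a)).
Proof.
move=> hp hl; apply: (ptime_ext (f := fun a => ~~ nilp (filter (p a) (l a)))).
  by move=> a; rewrite /nilp size_filter has_count lt0n.
by apply: ptime_neg; apply: ptime_null; apply: ptime_filter.
Qed.

Lemma ptime_all (p : A -> B -> bool) (l : A -> seq B) :
  ptime (fun q : A * B => p q.1 q.2) -> ptime l ->
  ptime (fun a => all (p a) (l a)).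
Proof.
move=> hp hl; apply: (ptime_ext (f := fun a => ~~ has (fun b => ~~ p a b) (l a))).
  by move=> a; rewrite -all_predC; apply: eq_all => b /=; rewrite negbK.
by apply: ptime_neg; apply: ptime_has => //; apply: ptime_neg.
Qed.

(** A fold over [nseq (n a) tt]; the number of rounds is polynomial because numbers are unary. *)
Lemma ptime_iter (n : A -> nat) (f : A -> B -> B) (b : A -> B) (q : A -> nat) :
  ptime n -> ptime (fun p : A * B => f p.1 p.2) -> ptime b -> pbound q ->
  (forall a k, k <= n a -> esize (iter k (f a) (b a)) <= q a) ->
  ptime (fun a => iter (n a) (f a) (b a)).
Proof.
move=> hn hf hb hq h.
have e (g : B -> B) x (s : seq unit) : foldl (fun y _ => g y) x s = iter (size s) g x.
  by elim: s x => //= _ s IH x; rewrite IH -iterSr.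
apply: (ptime_ext (f := fun a => foldl (fun y _ => f a y) (b a) (nseq (n a) tt))).
  by move=> a; rewrite e size_nseq.
apply: (ptime_foldl (f := fun a y _ => f a y) (q := q)) => //.
- by apply: (ptime_comp2 hf); pvar.
- exact: ptime_nseq_unit.
move=> a l1 l2 el; rewrite e; apply: h.
by have := congr1 size el; rewrite size_nseq size_cat => ->; rewrite leq_addr.
Qed.

Lemma ptime_size_seq (l : A -> seq B) : ptime l -> ptime (fun a => size (l a)).
Proof.
move=> hl.
apply: (ptime_ext (f := fun a => size (map (fun=> tt) (l a)))).
  by move=> a; rewrite size_map.
apply: (ptime_comp (f := fun a => map (fun=> tt) (l a))).
  by apply: (ptime_map (f := fun _ _ => tt)) => //; apply: ptime_const.
by apply: ptime_recode; elim=> //= -[] s ->.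
Qed.
End PtimeIterators.

(** * Unary arithmetic and further list functions *)

Lemma ptime_succ (A : codedType) (m : A -> nat) : ptime m -> ptime (fun a => (m a).+1).
Proof.
move=> hm; have [c [g [hg h]]] := ptime_pair (ptime_const tt) hm.
by exists c, g; split.
Qed.

Lemma ptime_pred (A : codedType) (m : A -> nat) : ptime m -> ptime (fun a => (m a).-1).
Proof.
move=> hm; apply: (ptime_ext (f := fun a => size (behead (nseq (m a) tt)))).
  by move=> a; rewrite size_behead size_nseq.
by apply: ptime_size_seq; apply: ptime_behead; apply: ptime_nseq_unit.
Qed.

Lemma ptime_add (A : codedType) (m n : A -> nat) : ptime m -> ptime n -> ptime (fun a => m a + n a).
Proof.
move=> hm hn; apply: (ptime_ext (f := fun a => iter (m a) S (n a))).
  by move=> a; rewrite iter_succn addnC.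
apply: (ptime_iter (f := fun _ => S) (q := fun a => 2 * (esize (m a) + esize (n a)))) => //.
- by rewrite /=; apply: ptime_succ; pvar.
- by pb.
by move=> a k km; rewrite iter_succn !esize_nat; lia.
Qed.

Lemma ptime_sub (A : codedType) (m n : A -> nat) : ptime m -> ptime n -> ptime (fun a => m a - n a).
Proof.
move=> hm hn; apply: (ptime_ext (f := fun a => iter (n a) predn (m a))).
  by move=> a; rewrite iter_predn.
apply: (ptime_iter (f := fun _ => predn) (q := fun a => esize (m a))) => //.
- by rewrite /=; apply: ptime_pred; pvar.
- by pb.
by move=> a k km; rewrite iter_predn !esize_nat; lia.
Qed.

Lemma ptime_leq (A : codedType) (m n : A -> nat) : ptime m -> ptime n -> ptime (fun a => m a <= n a).
Proof.
move=> hm hn; apply: (ptime_ext (f := fun a => nilp (nseq (m a - n a) tt))).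
  by move=> a; rewrite /nilp size_nseq.
by apply: ptime_null; apply: ptime_nseq_unit; apply: ptime_sub.
Qed.

Lemma ptime_eqn (A : codedType) (m n : A -> nat) : ptime m -> ptime n -> ptime (fun a => m a == n a).
Proof.
move=> hm hn; apply: (ptime_ext (f := fun a => (m a <= n a) && (n a <= m a))).
  by move=> a; rewrite eqn_leq.
by apply: ptime_and; apply: ptime_leq.
Qed.

Lemma ptime_min (A : codedType) (m n : A -> nat) : ptime m -> ptime n -> ptime (fun a => minn (m a) (n a)).
Proof.
move=> hm hn; apply: ptime_if => //.
by apply: ptime_leq => //; apply: ptime_succ.
Qed.

Lemma ptime_eq_sym (A : codedType) (x y : A -> sym) : ptime x -> ptime y -> ptime (fun a => x a == y a).
Proof.
move=> hx hy; apply: (ptime_ext (f := fun a => sym_nat (x a) == sym_nat (y a))).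
  by move=> a; case: (x a); case: (y a).
by apply: ptime_eqn; [apply: (ptime_comp hx) | apply: (ptime_comp hy)];
  apply: ptime_recode.
Qed.

Lemma ptime_mem (A : codedType) (x : A -> nat) (l : A -> seq nat) : ptime x -> ptime l ->
  ptime (fun a => x a \in l a).
Proof.
move=> hx hl; apply: (ptime_ext (f := fun a => has (fun y => y == x a) (l a))).
  by move=> a; rewrite -has_pred1.
apply: (@ptime_has A _ (fun a (y : nat) => y == x a)) => //.
apply: ptime_eqn; pvar; apply: (ptime_comp _ hx (f := fst)); pvar.
Qed.

Lemma ptime_iota (A : codedType) (m : A -> nat) : ptime m -> ptime (fun a => iota 0 (m a)).
Proof.
move=> hm.
have e k : iter k (fun p : nat * seq nat => (p.1.+1, p.1 :: p.2)) (0, [::]) =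
    (k, rev (iota 0 k)).
  elim: k => // k IH; rewrite iterS IH; congr pair.
  by rewrite -[k.+1]addn1 iotaD rev_cat.
apply: (ptime_ext (f := fun a => rev (iter (m a)
  (fun p : nat * seq nat => (p.1.+1, p.1 :: p.2)) (0, [::])).2)).
  by move=> a; rewrite e /= revK.
apply: ptime_rev; apply: ptime_snd.
apply: (ptime_iter (f := fun _ p => (p.1.+1, p.1 :: p.2)) (b := fun=> (0, [::]))
  (q := fun a => esize (m a) + (esize (m a) * (2 * esize (m a)) + 1) + 1)) => //.
- apply: ptime_pair; first by apply: ptime_succ; pvar.
  by apply: ptime_cons; pvar.
- exact: ptime_const.
- by pb.
move=> a k km; rewrite e esize_pair /= esize_rev addn1 ltnS.
apply: leq_add; first by rewrite !esize_nat; lia.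
apply: leq_trans (esize_seq_le (n := 2 * k) _) _.
  move=> x1 y x2 /(congr1 (fun s => y \in s)).
  by rewrite mem_cat inE eqxx orbT mem_iota esize_nat; lia.
by rewrite size_iota esize_nat leq_add2r leq_mul //; lia.
Qed.

(** Turns [sumn] and [flatten], which are right folds, into the left folds of the class. *)
Lemma foldl_monoid (T : Type) (op : T -> T -> T) e : associative op ->
  left_id e op -> right_id e op -> forall s, foldl op e s = foldr op e s.
Proof.
move=> opA op1 op2 s; suff H x : foldl op x s = op x (foldr op e s) by rewrite H op1.
by elim: s x => //= y s IH x; rewrite IH opA.
Qed.

Lemma ptime_sumn (A : codedType) (l : A -> seq nat) : ptime l ->
  ptime (fun a => sumn (l a)).
Proof.
have e := foldl_monoid addnA add0n addn0.
move=> hl; apply: ptime_ext (fun a => e (l a)) _.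
apply: (ptime_foldl (f := fun _ => addn) (a := fun=> 0)
  (q := fun a => 2 * esize (l a))) => //.
- by rewrite /=; apply: ptime_add; pvar.
- exact: ptime_const.
- by pb.
move=> a l1 l2 el; rewrite e -/(sumn l1) el.
have := esize_cat l1 l2; have := esize_gt0 l2.
have : sumn l1 < esize l1.
  by elim: (l1) => //= x s IH; rewrite esize_cons esize_nat; lia.
by rewrite esize_nat; lia.
Qed.

Lemma ptime_drop (A B : codedType) (n : A -> nat) (l : A -> seq B) : ptime n -> ptime l ->
  ptime (fun a => drop (n a) (l a)).
Proof.
have e k (s : seq B) : iter k behead s = drop k s.
  by elim: k => [|k IH] /=; rewrite ?drop0 // IH -drop1 drop_drop addnC addn1.
move=> hn hl; apply: (ptime_ext (f := fun a => iter (n a) behead (l a))).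
  by move=> a; rewrite e.
apply: (ptime_iter (f := fun _ => behead) (q := fun a => esize (l a))) => //.
- by rewrite /=; apply: ptime_behead; pvar.
- exact: ptime_size.
move=> a k _; rewrite e -{2}(cat_take_drop k (l a)).
by have := esize_cat (take k (l a)) (drop k (l a)); have := esize_gt0 (take k (l a)); lia.
Qed.

Lemma ptime_nth (A B : codedType) (d : A -> B) (l : A -> seq B) (n : A -> nat) :
  ptime d -> ptime l -> ptime n -> ptime (fun a => nth (d a) (l a) (n a)).
Proof.
move=> hd hl hn; apply: (ptime_ext (f := fun a => head (d a) (drop (n a) (l a)))).
  by move=> a; rewrite -nth0 nth_drop addn0.
by apply: ptime_head => //; apply: ptime_drop.
Qed.

Lemma ptime_flatten (A B : codedType) (l : A -> seq (seq B)) : ptime l ->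
  ptime (fun a => flatten (l a)).
Proof.
have e := foldl_monoid (@catA B) (@cat0s B) (@cats0 B).
move=> hl; apply: ptime_ext (fun a => e (l a)) _.
apply: (ptime_foldl (f := fun _ => cat) (a := fun=> [::]) (q := fun a => esize (l a))) => //.
- by rewrite /=; apply: ptime_cat; pvar.
- exact: ptime_const.
- exact: ptime_size.
move=> a l1 l2 el; rewrite e -/(flatten l1) el.
have := esize_cat l1 l2; have := esize_gt0 l2.
have : esize (flatten l1) <= esize l1.
  elim: (l1) => //= x s IH; rewrite esize_cons.
  by have := esize_cat x (flatten s); lia.
by lia.
Qed.

(** * The elimination algorithm *)

Lemma ptime_nat_of_bool (A : codedType) (b : A -> bool) :
  ptime b -> ptime (fun a => nat_of_bool (b a)).
Proof. by move=> hb; apply: (ptime_comp hb); apply: ptime_recode. Qed.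

Lemma ptime_lift (A B C : codedType) (f : A -> B) :
  ptime f -> ptime (fun p : A * C => f p.1).
Proof.
move=> hf; apply: (ptime_comp (f := fun p : A * C => p.1) _ hf).
by apply: ptime_fst; apply: ptime_id.
Qed.

Lemma ptime_proj (A B : codedType) : ptime (fun p : A * B => p.1) /\ ptime (fun p : A * B => p.2).
Proof. by split; [apply: ptime_fst | apply: ptime_snd]; apply: ptime_id. Qed.

(* Succeeds only on a literal conditional: applying ptime_if to other functions
   would send the unifier unfolding them. *)
Ltac check_if T g :=
  let _ := constr:(fun y : T =>
    ltac:(let b := eval cbv beta in (g y) in
          lazymatch b with if _ then _ else _ => exact true end)) in idtac.
Ltac pt_step :=
  lazymatch goal with
  | |- ptime fst => exact: (proj1 (ptime_proj _ _))
  | |- ptime behead => exact: (ptime_behead ptime_id)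
  | |- ptime snd => exact: (proj2 (ptime_proj _ _))
  | |- ptime (fun _ => ?c) => exact: ptime_const
  | |- ptime (fun x => x) => exact: ptime_id
  | |- ptime (fun x => fst (@?f x)) => apply: ptime_fst
  | |- ptime (fun x => snd (@?f x)) => apply: ptime_snd
  | |- ptime (fun x => pair (@?f x) (@?g x)) => apply: ptime_pair
  | |- ptime (fun x => cons (@?f x) (@?g x)) => apply: ptime_cons
  | |- ptime (fun x => negb (@?f x)) => apply: ptime_neg
  | |- ptime (fun x => andb (@?f x) (@?g x)) => apply: ptime_and
  | |- ptime (fun x => orb (@?f x) (@?g x)) => apply: ptime_or
  | |- ptime (fun x => nat_of_bool (@?b x)) => apply: ptime_nat_of_bool
  | |- ptime (fun x => head (@?f x) (@?g x)) => apply: ptime_head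
  | |- ptime (fun x => behead (@?f x)) => apply: ptime_behead
  | |- ptime (fun x => nth (@?d x) (@?f x) (@?g x)) => apply: ptime_nth
  | |- ptime (fun x => size (@?f x)) => apply: ptime_size_seq
  | |- ptime (fun x => rev (@?f x)) => apply: ptime_rev
  | |- ptime (fun x => flatten (@?f x)) => apply: ptime_flatten
  | |- ptime (fun x => sumn (@?f x)) => apply: ptime_sumn
  | |- ptime (fun x => cat (@?f x) (@?g x)) => apply: ptime_cat
  | |- ptime (fun x => iota 0 (@?f x)) => apply: ptime_iota
  | |- ptime (fun x => minn (@?f x) (@?g x)) => apply: ptime_min
  | |- ptime (fun x => S (@?f x)) => apply: ptime_succ
  | |- ptime (fun x => leq (@?f x) (@?g x)) => apply: ptime_leq
  | |- ptime (fun x => @eq_op ?T (@?f x) (@?g x)) =>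
      first [ apply: ptime_eqn | apply: ptime_eqb | apply: ptime_eq_sym ]
  | |- ptime (fun x => @in_mem _ (@?f x) (@?g x)) => apply: ptime_mem
  | |- ptime (fun x => map (@?f x) (@?g x)) => apply: ptime_map; rewrite /=
  | |- ptime (fun x => filter (@?f x) (@?g x)) => apply: ptime_filter; rewrite /=
  | |- ptime (fun x => has (@?f x) (@?g x)) => apply: ptime_has; rewrite /=
  | |- ptime (fun x => all (@?f x) (@?g x)) => apply: ptime_all; rewrite /=
  | |- ptime (fun x : ?T => @?g x) => check_if T g; apply: ptime_if
  end.
Ltac pt := repeat first [assumption | pt_step].

(* A factor ((x, y), w) contributes w_{ab} to the cost when x has value a and y
   has value b; an assignment is given by the list of the variables that are
   true. *)
Definition factor := ((nat * nat) * ((nat * nat) * (nat * nat)))%type.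
Definition fval (f : factor) (a b : bool) : nat :=
  if a then (if b then f.2.2.2 else f.2.2.1) else (if b then f.2.1.2 else f.2.1.1).
Definition cost (fs : seq factor) (s : seq nat) : nat :=
  sumn [seq fval f (f.1.1 \in s) (f.1.2 \in s) | f <- fs].
Definition assign (x : nat) (a : bool) (s : seq nat) : seq nat :=
  if a then x :: s else [seq y <- s | y != x].
Definition incident (x : nat) (f : factor) : bool := (f.1.1 == x) || (f.1.2 == x).
Definition endpoints (fs : seq factor) : seq nat :=
  flatten [seq [:: f.1.1; f.1.2] | f <- fs].
Definition nbrs (x : nat) (fs : seq factor) : seq nat :=
  foldl (fun acc u => if (u == x) || (u \in acc) then acc else u :: acc) [::]
    (endpoints [seq f <- fs | incident x f]).

Definition min_entry (x y z : nat) (fs : seq factor) (b c : bool) : nat :=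
  minn (cost fs (assign x false (assign y b (assign z c [::]))))
       (cost fs (assign x true (assign y b (assign z c [::])))).
Definition new_factor (x y z : nat) (fs : seq factor) : factor :=
  ((y, z), ((min_entry x y z fs false false, min_entry x y z fs false true),
            (min_entry x y z fs true false, min_entry x y z fs true true))).
(** The defaults of [head] cover the small cases. With a single neighbour both ends of the new
    factor are [y] and only its diagonal is ever read. With none both ends are [x] itself; the outer
    assignment to [x] then overrides the others, so the factor is constant, although it still
    mentions [x]. *)
Definition eliminate (x : nat) (fs : seq factor) : seq factor :=
  let y := head x (nbrs x fs) in
  let z := head y (behead (nbrs x fs)) in
  new_factor x y z [seq f <- fs | incident x f] :: [seq f <- fs | ~~ incident x f].
(** The default 0 makes the function total; the correctness proof shows that the list is nonempty
    while variables remain. *)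
Definition pick_var (vs : seq nat) (fs : seq factor) : nat :=
  head 0 [seq x <- vs | size (nbrs x fs) <= 2].

(** The last component records each eliminated variable with the factors present just before its
    elimination, latest first, which is the order of back-substitution. *)
Definition elim_state := (seq nat * seq factor * seq (nat * seq factor))%type.
Definition elim_step (st : elim_state) : elim_state :=
  let x := pick_var st.1.1 st.1.2 in
  (([seq y <- st.1.1 | y != x], eliminate x st.1.2), (x, st.1.2) :: st.2).
Definition best (fs : seq factor) (x : nat) (s : seq nat) : seq nat :=
  if cost fs (assign x true s) < cost fs (assign x false s)
  then assign x true s else assign x false s.
Definition optimize (m : nat) (fs : seq factor) : seq nat :=
  foldl (fun s p => best p.2 p.1 s) [::]
    (iter m elim_step ((iota 0 m, fs), [::])).2.

(** * Running time of the elimination algorithm *)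

Section CostTime.
Variable A : codedType.
Implicit Types (x y z : A -> nat) (fs : A -> seq factor) (s : A -> seq nat) (b c : A -> bool).

Lemma ptime_cost fs s : ptime fs -> ptime s -> ptime (fun a => cost (fs a) (s a)).
Proof.
move=> hf hs.
have hs' : ptime (fun p : A * factor => s p.1) by apply: ptime_lift.
rewrite /cost /fval; pt => //.
Qed.

Lemma ptime_assign x b s : ptime x -> ptime b -> ptime s ->
  ptime (fun a => assign (x a) (b a) (s a)).
Proof.
move=> hx hb hs.
have hx' : ptime (fun p : A * nat => x p.1) by apply: ptime_lift.
rewrite /assign; pt => //.
Qed.

Lemma ptime_incident x (f : A -> factor) : ptime x -> ptime f ->
  ptime (fun a => incident (x a) (f a)).
Proof. by move=> hx hf; rewrite /incident; pt. Qed.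
End CostTime.

Section EliminateTime.
Variable A : codedType.
Implicit Types (x y z : A -> nat) (fs : A -> seq factor) (s : A -> seq nat) (b c : A -> bool).

Lemma ptime_incidents x fs : ptime x -> ptime fs ->
  ptime (fun a => [seq f <- fs a | incident (x a) f]) /\
  ptime (fun a => [seq f <- fs a | ~~ incident (x a) f]).
Proof.
move=> hx hf.
have hx' : ptime (fun p : A * factor => x p.1) by apply: ptime_lift.
by split; pt => //; apply: ptime_incident => //; pt.
Qed.

Lemma ptime_nbrs x fs : ptime x -> ptime fs -> ptime (fun a => nbrs (x a) (fs a)).
Proof.
move=> hx hf; have [hi _] := ptime_incidents hx hf.
have he : ptime (fun a => endpoints [seq f <- fs a | incident (x a) f]).
  by rewrite /endpoints; pt.
rewrite /nbrs; apply: (@ptime_foldl A coded_nat (coded_seq coded_nat)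
  (fun a acc u => if (u == x a) || (u \in acc) then acc else u :: acc) _ (fun=> [::])
  (fun a => esize (endpoints [seq f <- fs a | incident (x a) f]))) => //.
- have hx' : ptime (fun p : A * seq nat * nat => x p.1.1).
    by apply: (@ptime_lift _ _ _ (fun p : A * seq nat => x p.1)); apply: ptime_lift.
  by rewrite /=; pt.
- by pt.
- exact: ptime_size.
move=> a l1 l2 ->.
have H l acc : esize (foldl (fun acc u => if (u == x a) || (u \in acc) then acc else u :: acc)
    acc l) + 1 <= esize l + esize acc.
  elim: l acc => [|u l IH] acc /=; first by rewrite esize_nil addnC.
  apply: leq_trans (IH _) _; rewrite esize_cons; case: ifP => _; first by lia.
  by rewrite esize_cons; lia.
have h1 := esize_cat l1 l2; have h2 := esize_gt0 l2.
apply: (@leq_trans (esize l1)); last by lia.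
by have := H l1 [::]; rewrite esize_nil leq_add2r.
Qed.

Lemma ptime_min_entry x y z fs b c :
  ptime x -> ptime y -> ptime z -> ptime fs -> ptime b -> ptime c ->
  ptime (fun a => min_entry (x a) (y a) (z a) (fs a) (b a) (c a)).
Proof.
move=> hx hy hz hf hb hc; rewrite /min_entry; pt; apply: ptime_cost => //;
by do ?apply: ptime_assign; pt.
Qed.

Lemma ptime_new_factor x y z fs : ptime x -> ptime y -> ptime z -> ptime fs ->
  ptime (fun a => new_factor (x a) (y a) (z a) (fs a)).
Proof.
move=> hx hy hz hf; rewrite /new_factor; pt => //; apply: ptime_min_entry => //; pt.
Qed.

Lemma ptime_eliminate x fs : ptime x -> ptime fs ->
  ptime (fun a => eliminate (x a) (fs a)).
Proof.
move=> hx hf; have [h1 h2] := ptime_incidents hx hf.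
have hn := ptime_nbrs hx hf.
rewrite /eliminate /=; apply: ptime_cons => //.
by apply: ptime_new_factor; pt.
Qed.
End EliminateTime.

Section StepTime.
Variable A : codedType.
Implicit Types (x y z : A -> nat) (fs : A -> seq factor) (s : A -> seq nat) (b c : A -> bool).

Lemma ptime_pick_var s fs : ptime s -> ptime fs ->
  ptime (fun a => pick_var (s a) (fs a)).
Proof.
move=> hs hf; have hf' : ptime (fun p : A * nat => fs p.1) by apply: ptime_lift.
rewrite /pick_var; pt => //; apply: ptime_nbrs => //; pt.
Qed.

Lemma ptime_best x fs s : ptime x -> ptime fs -> ptime s ->
  ptime (fun a => best (fs a) (x a) (s a)).
Proof.
move=> hx hf hs; rewrite /best; pt; try apply: ptime_cost => //; apply: ptime_assign => //; pt.
Qed.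
End StepTime.

Lemma ptime_elim_step : ptime elim_step.
Proof.
have hp (A : codedType) (f : A -> elim_state) : ptime f ->
    ptime (fun a => pick_var (f a).1.1 (f a).1.2).
  by move=> hf; apply: ptime_pick_var; pt.
rewrite /elim_step /=.
apply: (ptime_ext (f := fun st : elim_state => (([seq y <- st.1.1 | y != pick_var st.1.1 st.1.2],
  eliminate (pick_var st.1.1 st.1.2) st.1.2), (pick_var st.1.1 st.1.2, st.1.2) :: st.2))) => //.
pt; try apply: ptime_eliminate; pt.
all: try by apply: hp; pt.
Qed.

Lemma mem_endpoints u fs :
  (u \in endpoints fs) = has (incident u) fs.
Proof.
elim: fs => //= f fs IH; rewrite /endpoints /= !inE -/(endpoints fs) IH /incident.
by rewrite ![u == _]eq_sym orbA.
Qed.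

Lemma mem_nbrs u x fs :
  (u \in nbrs x fs) = (u != x) && has (fun f => incident x f && incident u f) fs.
Proof.
have -> : has (fun f => incident x f && incident u f) fs =
    (u \in endpoints [seq f <- fs | incident x f]).
  by rewrite mem_endpoints; elim: fs => //= f fs ->; case: (incident x f).
rewrite /nbrs; move: (endpoints _) => l.
suff H acc : (u \in foldl (fun acc u => if (u == x) || (u \in acc) then acc else u :: acc) acc l)
    = (u != x) && (u \in l) || (u \in acc) by rewrite H in_nil orbF.
elim: l acc => [|v l IH] acc /=; first by rewrite andbF.
rewrite IH inE; case: ifP => [/orP[/eqP->|va]|/norP[/negbTE vx _]].
- by case: (u =P x) => //= _; case: (u \in l).
- by case: (u =P v) => // ->; rewrite va !orbT.
- by rewrite inE; case: (u =P v) => [->|]; rewrite ?vx ?orbT.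
Qed.

Lemma nbrs_uniq x fs : uniq (nbrs x fs).
Proof.
rewrite /nbrs; move: (endpoints _) => l; have : uniq (Nil nat) by [].
elim: l [::] => //= v l IH acc ua; apply: IH; case: ifP => // /norP[_ va].
by rewrite /= va.
Qed.

Definition wmax (f : factor) : nat :=
  maxn (maxn f.2.1.1 f.2.1.2) (maxn f.2.2.1 f.2.2.2).
Definition total (fs : seq factor) : nat := sumn (map wmax fs).

Lemma cost_total fs s : cost fs s <= total fs.
Proof.
elim: fs => //= f fs IH; apply: leq_add IH.
by rewrite /fval /wmax; case: (_ \in s); case: (_ \in s); rewrite !leq_max leqnn ?orbT.
Qed.

Lemma total_filterC p fs :
  total [seq f <- fs | p f] + total [seq f <- fs | ~~ p f] = total fs.
Proof.
elim: fs => // f fs IH; have -> : total (f :: fs) = wmax f + total fs by [].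
by rewrite -IH /=; case: (p f) => /=; rewrite /total /=; lia.
Qed.

(** Every entry of the new factor is the cost of the removed factors under some assignment, hence at
    most the sum of their largest entries. *)
Lemma total_eliminate x fs : total (eliminate x fs) <= total fs.
Proof.
rewrite -[leqRHS](total_filterC (incident x)) /eliminate /= /total /= leq_add2r.
by rewrite /wmax /= !geq_max !geq_min !cost_total.
Qed.

Definition names_le (M : nat) (fs : seq factor) := all (fun u => u <= M) (endpoints fs).

Lemma names_le_eliminate M x fs : x <= M -> names_le M fs -> names_le M (eliminate x fs).
Proof.
move=> xM /allP fsM; have nM u : u \in nbrs x fs -> u <= M.
  rewrite mem_nbrs => /andP[_ /hasP[f fin /andP[_ uf]]]; apply: fsM.
  by rewrite mem_endpoints; apply/hasP; exists f.
have yM : head x (nbrs x fs) <= M.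
  by case: (nbrs x fs) nM => //= y l; apply; rewrite mem_head.
apply/allP => u; rewrite mem_endpoints /= => /orP[/orP[] /eqP <- //|].
  case: (nbrs x fs) nM yM => //= y [|z l] //= h _; apply: h.
  by rewrite !inE eqxx orbT.
case/hasP => f; rewrite mem_filter => /andP[_ fin] uf; apply: fsM.
by rewrite mem_endpoints; apply/hasP; exists f.
Qed.

Lemma esize_factor (f : factor) :
  esize f = 2 * (f.1.1 + f.1.2 + f.2.1.1 + f.2.1.2 + f.2.2.1 + f.2.2.2) + 11.
Proof.
by case: f => [[x y] [[a b] [c d]]]; rewrite !(esize_pair, esize_nat) /=; lia.
Qed.

(** A factor holds six numbers bounded by [M], coded in at most 12 [M] + 11 symbols, and its list
    cell takes one more. *)
Lemma esize_factors M (fs : seq factor) : names_le M fs -> total fs <= M ->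
  esize fs <= size fs * (12 * M + 12) + 1.
Proof.
elim: fs => // f fs IH; rewrite /names_le /= => /and3P[h1 h2 h3] tM.
have t1 : wmax f + total fs <= M by [].
rewrite esize_cons; have := IH h3; have : wmax f <= M by lia.
rewrite /wmax !geq_max => /andP[/andP[w1 w2] /andP[w3 w4]].
by rewrite esize_factor; lia.
Qed.

Lemma esize_total (fs : seq factor) : names_le (esize fs) fs /\ total fs <= esize fs.
Proof.
suff [h1 h2] : all (fun u => 2 * u <= esize fs) (endpoints fs) /\ total fs <= esize fs.
  by split=> //; apply: sub_all h1 => u; lia.
elim: fs => // f fs [IH1 IH2]; rewrite esize_cons.
have : 2 * f.1.1 <= esize f /\ 2 * f.1.2 <= esize f /\ wmax f <= esize f.
  by rewrite esize_factor /wmax; lia.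
case=> h1 [h2 h3]; split; last by rewrite /total /= -/(total fs); lia.
rewrite /=; apply/and3P; split; [lia|lia|].
by apply: sub_all IH1 => u; lia.
Qed.

(** A step adds at most one factor, introduces no name above [M] and does not increase the total. So
    [E] bounds the code of every factor list that occurs, and each of the [k] records of the trace
    is bounded through it. *)
Lemma elim_step_inv n M fs k (st := iter k elim_step ((iota 0 n, fs), [::])) :
  n <= M -> names_le M fs -> total fs <= M ->
  let E := (size fs + k) * (12 * M + 12) + 1 in
  [/\ all (fun u => u <= M) st.1.1 /\ size st.1.1 <= n, names_le M st.1.2,
      total st.1.2 <= M, size st.1.2 <= size fs + k
    & esize st.2 <= k * (E + 2 * M + 3) + 1].
Proof.
move=> nM fM tM; rewrite /st {st} /=; elim: k => [|k [[IH1 IH2] IH3 IH4 IH5 IH6]].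
  rewrite /= size_iota addn0 leqnn; split=> //; split=> //.
  by apply/allP => u; rewrite mem_iota; lia.
rewrite iterS; set st := iter k _ _ in IH1 IH2 IH3 IH4 IH5 IH6 *.
have xM : pick_var st.1.1 st.1.2 <= M.
  rewrite /pick_var; case e: (filter _ _) => [|x l] //=.
  have : x \in [seq x <- st.1.1 | size (nbrs x st.1.2) <= 2] by rewrite e mem_head.
  by rewrite mem_filter => /andP[_ /(allP IH1)].
split=> /=.
- split; first by apply/allP => u; rewrite mem_filter => /andP[_ /(allP IH1)].
  by rewrite size_filter (leq_trans (count_size _ _)).
- exact: names_le_eliminate.
- exact: leq_trans (total_eliminate _ _) IH4.
- rewrite size_filter addnS ltnS (leq_trans (count_size _ _)) //.
rewrite esize_cons esize_pair /= esize_nat.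
have := esize_factors IH3 IH4.
have : size st.1.2 * (12 * M + 12) <= (size fs + k) * (12 * M + 12) by rewrite leq_mul2r IH5 orbT.
have -> : (size fs + k.+1) * (12 * M + 12) = (size fs + k) * (12 * M + 12) + (12 * M + 12) by lia.
move: ((size fs + k) * _) IH6 (size _ * _) => X IH6 Y YX Ys.
have : k * (X + 1 + 2 * M + 3) <= k * (X + (12 * M + 12) + 1 + 2 * M + 3).
  by rewrite leq_mul2l; lia.
rewrite mulSn; lia.
Qed.

Lemma esize_assign x b s : esize (assign x b s) <= esize x + esize s + 1.
Proof.
case: b; first by rewrite esize_cons addn1.
by apply: leq_trans (esize_filter _ _) _; lia.
Qed.

Lemma ptime_optimize (A : codedType) (m : A -> nat) (fs : A -> seq factor) :
  ptime m -> ptime fs -> ptime (fun a => optimize (m a) (fs a)).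
Proof.
move=> hm hf.
(* A common bound on the variables, the names in the factors and their total. *)
pose M a := m a + esize (fs a).
pose E a := (size (fs a) + m a) * (12 * M a + 12) + 1.
have pm : pbound m.
  by apply: pbound_le (ptime_size hm) => a; rewrite esize_nat; lia.
have psz : pbound (fun a => size (fs a)).
  by apply: pbound_le (ptime_size hf) => a; rewrite ltnW // size_esize.
have pM : pbound M by rewrite /M; pb.
have pE : pbound E by rewrite /E; pb.
have hit : ptime (fun a => iter (m a) elim_step ((iota 0 (m a), fs a), [::])).
  apply: (ptime_iter (f := fun _ => elim_step)
    (q := fun a => m a * (2 * M a + 2) + 1 + E a + (m a * (E a + 2 * M a + 3) + 1) + 2)) => //.
  - by apply: (ptime_comp _ ptime_elim_step); pt.
  - by pt.
  - by pb.
  move=> a k km; have [nM tM] := esize_total (fs a).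
  have nM' : names_le (M a) (fs a).
    by apply: sub_all nM => u; rewrite /M; lia.
  have [||[h1 h2] h3 h4 h5 h6] := @elim_step_inv (m a) (M a) (fs a) k _ nM'.
  - by rewrite /M leq_addr.
  - by rewrite /M (leq_trans tM) // leq_addl.
  move: h1 h2 h3 h4 h5 h6; set st := iter k _ _ => h1 h2 h3 h4 h5 h6.
  have kE : (size (fs a) + k) * (12 * M a + 12) + 1 <= E a.
    by rewrite /E leq_add2r leq_mul2r leq_add2l km orbT.
  rewrite esize_pair esize_pair.
  have e1 : esize st.1.1 <= m a * (2 * M a + 2) + 1.
    apply: leq_trans (esize_seq_le (n := 2 * M a + 1) _) _.
      move=> x1 y x2 e; rewrite esize_nat; move: h1.
      by rewrite e all_cat /= => /and3P[_ ? _]; lia.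
    by rewrite leq_add2r -addnS leq_mul.
  have e2 : esize st.1.2 <= E a.
    apply: leq_trans (esize_factors h3 h4) _; apply: leq_trans kE.
    by rewrite leq_add2r leq_mul2r h5 orbT.
  have e3 : esize st.2 <= m a * (E a + 2 * M a + 3) + 1.
    by apply: leq_trans h6 _; rewrite leq_add2r; apply: leq_mul => //; rewrite 2!leq_add2r.
  rewrite addSn [leqRHS]addn2 2!ltnS; exact: leq_add (leq_add e1 e2) e3.
rewrite /optimize.
apply: (ptime_foldl (f := fun _ s p => best p.2 p.1 s) (a := fun=> [::])
  (q := fun a => esize (iter (m a) elim_step ((iota 0 (m a), fs a), [::])).2)) => //.
- by rewrite /=; apply: ptime_best; pt.
- exact: ptime_snd.
- exact: ptime_const.
- by apply: ptime_size; apply: ptime_snd.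
move=> a l1 l2 ->; have h1 := esize_cat l1 l2; have h2 := esize_gt0 l2.
suff H : forall s, esize (foldl (fun s p => best p.2 p.1 s) s l1) + 1 <= esize s + esize l1.
  apply: (@leq_trans (esize l1)); last by lia.
  by have := H [::]; rewrite esize_nil addnC leq_add2l.
elim: l1 {h1} => [|p l IH] s /=; first by rewrite esize_nil.
apply: leq_trans (IH _) _; rewrite esize_cons esize_pair.
have H : esize (best p.2 p.1 s) <= esize p.1 + esize s + 1.
  by rewrite /best; case: ifP => _; apply: esize_assign.
by move: (esize (best _ _ _)) H => X; lia.
Qed.

(** * Parsing the input *)

(** Parsers iterate a step as often as the word has letters, and the step idles once it is done. The
    default [SB] stops it on an exhausted word. *)
Definition parse_nat_step (st : nat * seq sym) : nat * seq sym :=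
  if head SB st.2 == SA then (st.1.+1, behead st.2) else st.
Definition parse_nat (s : seq sym) : nat * seq sym :=
  let r := iter (size s) parse_nat_step (0, s) in (r.1, behead r.2).
Definition parse_bool (s : seq sym) : bool * seq sym :=
  (0 < (parse_nat s).1, (parse_nat s).2).

Section Combinators.
Variables A B : codedType.
Implicit Types (p : seq sym -> A * seq sym) (q : seq sym -> B * seq sym).

Definition parse_pair p q (s : seq sym) : (A * B) * seq sym :=
  (((p s).1, (q (p s).2).1), (q (p s).2).2).

Definition parse_list_step p (st : seq A * seq sym) : seq A * seq sym :=
  if head SR st.2 == SR then st else ((p st.2).1 :: st.1, (p st.2).2).
Definition parse_list p (s : seq sym) : seq A * seq sym :=
  let r := iter (size s) (parse_list_step p) ([::], behead s) in
  (rev r.1, behead r.2).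

(* Parsers shorten their input, which bounds the intermediate results of
   parse_list even on ill-formed words. *)
Definition parser p : Prop := ptime p /\ forall s, size (p s).2 <= size s.

Definition parses (e : A -> seq sym) p : Prop :=
  forall a r, p (e a ++ r) = (a, r).
End Combinators.

Lemma esize_word (s : seq sym) : esize s <= 8 * size s + 1.
Proof.
rewrite addnC mulnC addnC; apply: leq_trans (esize_seq_le (n := 7) _) _ => //.
by move=> ? a ? _; apply: esize_sym.
Qed.

Lemma size_word (s : seq sym) : size s < esize s.
Proof. exact: size_esize. Qed.

Lemma parser_nat : parser parse_nat.
Proof.
have H k s : let r := iter k parse_nat_step (0, s) in r.1 <= k /\ size r.2 <= size s.
  elim: k => //= k; move: (iter k _ _) => -[n t] /= [IH1 IH2].
  rewrite /parse_nat_step; case: ifP => _ /=; last by rewrite leqW.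
  by rewrite ltnS size_behead (leq_trans (leq_pred _)).
split=> [|s]; last by have [_] := H (size s) s; rewrite /= size_behead; lia.
rewrite /parse_nat /=.
apply: (@ptime_comp _ _ _ (fun s => iter (size s) parse_nat_step (0, s))
  (fun r => (r.1, behead r.2))); last by pt.
apply: (@ptime_iter (coded_seq coded_sym) (coded_prod coded_nat (coded_seq coded_sym))
  (fun s => size s) (fun _ => parse_nat_step) (fun s => (0, s))
  (fun s => 2 * esize s + 1 + (8 * esize s + 1) + 1)).
- by pt.
- apply: (@ptime_comp _ _ _ _ parse_nat_step); first by pt.
  by rewrite /parse_nat_step; pt.
- by pt.
- by pb.
move=> s k ks; have [h1 h2] := H k s; rewrite esize_pair addn1 ltnS.
have := size_word s; have := esize_word (iter k parse_nat_step (0, s)).2.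
move: h1 h2; move: (iter k _ _) => -[n t] /= h1 h2; rewrite esize_nat.
move=> le1 le2; apply: leq_add; last by apply: leq_trans le1 _; lia.
by have := leq_ltn_trans (leq_trans h1 ks) le2; lia.
Qed.

Lemma parser_bool : parser parse_bool.
Proof.
have [h1 h2] := parser_nat; split=> //.
by rewrite /parse_bool; pt; apply: (@ptime_comp _ _ _ (fun s => s) parse_nat); pt.
Qed.

Lemma parser_pair (A B : codedType) (p : seq sym -> A * seq sym)
  (q : seq sym -> B * seq sym) : parser p -> parser q -> parser (parse_pair p q).
Proof.
case=> hp sp [hq sq]; split=> [|s]; last by apply: leq_trans (sq _) (sp _).
have h : ptime (fun s => q (p s).2).
  by apply: (@ptime_comp _ _ _ (fun s => (p s).2) q); pt.
by rewrite /parse_pair; pt.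
Qed.

Lemma parser_list (A : codedType) (p : seq sym -> A * seq sym) :
  parser p -> parser (parse_list p).
Proof.
case=> hp sp; have [c [k hk]] := ptime_size hp.
(* Each letter of the remaining word takes at most 7 symbols of code and one for its list cell; [K]
   bounds the result of [p] on any such word. *)
pose K (s : seq sym) := c * (8 * esize s + 1) ^ k.
have H i s : let r := iter i (parse_list_step p) ([::], behead s) in
    esize r.1 <= i * (K s).+1 + 1 /\ size r.2 <= size s.
  elim: i => [|i] /=; first by split; rewrite // size_behead leq_pred.
  move: (iter i _ _) => r [IH1 IH2].
  rewrite /parse_list_step; case: ifP => _ /=.
    by split=> //; apply: leq_trans IH1 _; rewrite leq_add2r leq_mul2r leqnSn orbT.
  split; last exact: leq_trans (sp _) IH2.
  rewrite esize_cons mulSn -addSn -addnA; apply: leq_add IH1; rewrite ltnS.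
  apply: (@leq_trans (esize (p r.2))); first by rewrite [leqRHS]esize_pair -addnS leq_addr.
  apply: leq_trans (hk _) _; rewrite leq_mul2l; apply/orP; right.
  suff : esize r.2 <= 8 * esize s + 1 by case: (k) => // k' ?; rewrite leq_exp2r.
  apply: leq_trans (esize_word _) _; rewrite leq_add2r leq_mul2l.
  exact: leq_trans IH2 (ltnW (size_word s)).
split=> [|s]; last by have [_] := H (size s) s; rewrite /= size_behead; lia.
rewrite /parse_list /=.
apply: (@ptime_comp _ _ _ (fun s => iter (size s) (parse_list_step p) ([::], behead s))
  (fun r => (rev r.1, behead r.2))); last by pt.
apply: (@ptime_iter (coded_seq coded_sym) (coded_prod (coded_seq A) (coded_seq coded_sym))
  (fun s => size s) (fun _ => parse_list_step p) (fun s => ([::], behead s))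
  (fun s => esize s * (K s + 1) + 1 + (8 * esize s + 1) + 1)).
- by pt.
- apply: (@ptime_comp _ _ _ _ (parse_list_step p)); first by pt.
  have h : ptime (fun st : seq A * seq sym => p st.2).
    by apply: (@ptime_comp _ _ _ (fun st : seq A * seq sym => st.2) p); pt.
  by rewrite /parse_list_step; pt.
- by pt.
- by rewrite /K; pb.
move=> s i si; have [h1 h2] := H i s; rewrite esize_pair addn1 ltnS.
apply: leq_add.
  apply: leq_trans h1 _; rewrite leq_add2r [K s + 1]addn1 leq_mul2r; apply/orP; right.
  exact: leq_trans si (ltnW (size_word s)).
apply: leq_trans (esize_word _) _; rewrite leq_add2r leq_mul2l.
exact: leq_trans h2 (ltnW (size_word s)).
Qed.

Lemma parses_nat : parses enc_nat parse_nat.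
Proof.
move=> n r; have H k m s : iter (n + k) parse_nat_step (m, enc_nat n ++ s) = (m + n, SB :: s).
  elim: n m => [|n IH] m; first by rewrite addn0; elim: k => //= k ->.
  by rewrite addSn iterSr /= IH addSnnS.
rewrite /parse_nat; have -> : size (enc_nat n ++ r) = n + (size r).+1.
  by rewrite /enc_nat !size_cat size_nseq /=; lia.
by rewrite H.
Qed.

Lemma parses_bool : parses enc_bool parse_bool.
Proof. by move=> b r; rewrite /parse_bool parses_nat; case: b. Qed.

Lemma parses_pair (A B : codedType) e1 e2 (p : seq sym -> A * seq sym)
    (q : seq sym -> B * seq sym) : parses e1 p -> parses e2 q ->
  parses (fun x => e1 x.1 ++ e2 x.2) (parse_pair p q).
Proof. by move=> hp hq [a b] r; rewrite /parse_pair -catA !(hp, hq). Qed.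

(** The hypothesis says that no element starts like the closing bracket and, through the default of
    [head], that none has an empty encoding. The latter makes the length of the word a sufficient
    number of rounds. *)
Lemma parses_list (A : codedType) e (p : seq sym -> A * seq sym) :
  (forall a, head SR (e a) != SR) -> parses e p ->
  parses (enc_list e) (parse_list p).
Proof.
move=> ne hp l r; rewrite /parse_list.
have H k m : iter (size l + k) (parse_list_step p) (m, flatten (map e l) ++ SR :: r) =
    (catrev l m, SR :: r).
  elim: l m => [|a l IH] m; first by rewrite add0n; elim: k => //= k ->.
  rewrite addSn iterSr /= -catA -IH; congr (iter _ _ _).
  rewrite /parse_list_step /= hp /=; have := ne a.
  by case: (e a) => [|b s] //= /negbTE ->.
have -> : behead (enc_list e l ++ r) = flatten (map e l) ++ SR :: r.
  by rewrite /= -catA.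
have le : size l <= size (enc_list e l ++ r).
  rewrite /enc_list /= !size_cat /=; suff : size l <= size (flatten (map e l)) by lia.
  elim: (l) => //= a l' IH; rewrite size_cat; have := ne a.
  by case: (e a) => //= ? ? _; lia.
by rewrite -(subnKC le) H /= catrevE cats0 revK.
Qed.

Definition vdata := (seq (nat * nat) * seq (seq statement))%type.
Definition data_of (v : voter) : vdata := (vedges v, vapp v).

Definition parse_edge := parse_pair parse_nat parse_nat.
Definition parse_literal := parse_pair parse_nat parse_bool.
Definition parse_stmt := parse_pair (parse_list parse_literal) parse_bool.
Definition parse_voter :=
  parse_pair (parse_list parse_edge) (parse_list (parse_list parse_stmt)).
Definition parse_instance := parse_pair parse_nat (parse_list parse_voter).

Lemma parser_instance : parser parse_instance.
Proof.
by do ?[exact: parser_nat | exact: parser_bool | apply: parser_pair | apply: parser_list].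
Qed.

Lemma enc_nat_head n s : head SR (enc_nat n ++ s) != SR.
Proof. by case: n. Qed.

Lemma parse_instanceP (I : instance) :
  parse_instance (enc_instance I) = ((nissues I, map data_of (voters I)), [::]).
Proof.
have hv : parses (fun d : vdata => enc_voter (Voter d.1 d.2)) parse_voter.
  apply: parses_pair; apply: parses_list.
  - by move=> a; apply: enc_nat_head.
  - by apply: parses_pair; apply: parses_nat.
  - by [].
  - apply: parses_list => //.
    apply: parses_pair parses_bool; apply: parses_list.
      by move=> a; apply: enc_nat_head.
    by apply: parses_pair parses_bool; apply: parses_nat.
have -> : enc_instance I = enc_nat (nissues I) ++
    enc_list (fun d : vdata => enc_voter (Voter d.1 d.2)) (map data_of (voters I)).
  by rewrite /enc_instance /enc_list -map_comp; congr (_ ++ _ :: flatten _ ++ _);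
    apply: eq_map => -[].
have := parses_pair parses_nat (parses_list _ hv)
  (nissues I, map data_of (voters I)) [::].
by rewrite cats0; apply.
Qed.

(** An issue without in-neighbours becomes its own parent, and its factor is read on the diagonal
    only. *)
Definition parent (d : vdata) (j : nat) : nat :=
  head j [seq e.1 | e <- d.1 & e.2 == j].
(** Variables of literals are not compared: with in-degree at most 1 they all are the parent, whose
    value is [b]. *)
Definition rejected (app : seq statement) (a b : bool) : bool :=
  ~~ has (fun st : statement => (st.2 == a) && all (fun p => p.2 == b) st.1) app.
Definition issue_factor (d : vdata) (j : nat) : factor :=
  let app := nth [::] d.2 j in
  ((j, parent d j),
   ((nat_of_bool (rejected app false false), nat_of_bool (rejected app false true)),
    (nat_of_bool (rejected app true false), nat_of_bool (rejected app true true)))).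
Definition instance_factors (m : nat) (ds : seq vdata) : seq factor :=
  flatten [seq [seq issue_factor d j | j <- iota 0 m] | d <- ds].
Definition outcome_word (m : nat) (s : seq nat) : seq sym :=
  SL :: flatten [seq (if j \in s then [:: SA; SB] else [:: SB]) | j <- iota 0 m] ++ [:: SR].
Definition solver (x : seq sym) : seq sym :=
  let I := (parse_instance x).1 in
  outcome_word I.1 (optimize I.1 (instance_factors I.1 I.2)).

Section SolverTime.
Variable A : codedType.

Lemma ptime_rejected (app : A -> seq statement) (a b : bool) : ptime app ->
  ptime (fun x => rejected (app x) a b).
Proof. by move=> h; rewrite /rejected; pt. Qed.

Lemma ptime_issue_factor (d : A -> vdata) (j : A -> nat) : ptime d -> ptime j ->
  ptime (fun x => issue_factor (d x) (j x)).
Proof.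
move=> hd hj; have hj' : ptime (fun p : A * (nat * nat) => j p.1) by apply: ptime_lift.
by rewrite /issue_factor /parent; pt; apply: ptime_rejected; pt.
Qed.
End SolverTime.

Lemma ptime_instance_factors (A : codedType) (m : A -> nat) (ds : A -> seq vdata) :
  ptime m -> ptime ds -> ptime (fun x => instance_factors (m x) (ds x)).
Proof.
move=> hm hd; have hm' : ptime (fun p : A * vdata => m p.1) by apply: ptime_lift.
rewrite /instance_factors; pt.
by apply: (@ptime_issue_factor _ (fun p : A * vdata * nat => p.1.2) (fun p => p.2)); pt.
Qed.

Lemma ptime_outcome_word (A : codedType) (m : A -> nat) (s : A -> seq nat) :
  ptime m -> ptime s -> ptime (fun x => outcome_word (m x) (s x)).
Proof.
move=> hm hs; have hs' : ptime (fun p : A * nat => s p.1) by apply: ptime_lift.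
by rewrite /outcome_word; pt.
Qed.

Lemma ptime_solver : ptime solver.
Proof.
have [hp _] := parser_instance.
have hI : ptime (fun x : seq sym => (parse_instance x).1) by exact: ptime_fst.
have ho : ptime (fun x => optimize (parse_instance x).1.1
    (instance_factors (parse_instance x).1.1 (parse_instance x).1.2)).
  by apply: ptime_optimize; last apply: ptime_instance_factors; pt.
exact: (ptime_outcome_word (ptime_fst hI) ho).
Qed.

(** * From polynomial-time functions to Turing machines *)

(** Stack A holds the reversed word, so the list is built from its last letter by prefixing a node
    and the code of a letter. *)
Definition load_loop : cmd :=
  Loop rA isSym (fun o =>
    if o is Some a then Seq (push_seq (ser (encode a))) (Push rT SB) else Skip).
Definition load_cmd : cmd := Seq (pour rT rA) (Seq (Push rT SA) load_loop).

Lemma load_loopP (l m : seq sym) b c :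
  exec load_loop (St (ser (encode m)) l b c)
    (St (ser (encode (catrev l m))) [::] b c) (9 * size l + 1).
Proof.
elim: l m => [|a l IH] m.
  by apply: ExecDone; rewrite StE //= popE; apply: ExecSkip.
apply: (@exec_le _ _ _ ((esize a + 1) + (9 * size l + 1)).+1).
  by have := esize_sym a; rewrite /=; lia.
apply: ExecLoop; last exact: (IH (a :: m)); rewrite StE //= popE.
exact: ExecSeq (push_seqP _ _ _ _ _) (push_T _ _ _ _ _).
Qed.

Lemma load_cmdP x : exec load_cmd (Stack x) (Stack (ser (encode x))) (11 * size x + 3).
Proof.
have -> : 11 * size x + 3 = (2 * size x + 1) + (1 + (9 * size (rev x) + 1)).
  by rewrite size_rev; lia.
apply: ExecSeq (pour_TA _ _ _ _) _; rewrite catrevE cats0.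
apply: ExecSeq (push_T _ _ _ _ _) _.
by have := load_loopP (rev x) [::] [::] [::]; rewrite catrevE revK cats0.
Qed.

(** Decodes a unary number by shortening the list [acc] of candidates with every [SB]. Fuel 4 covers
    at most three nodes and the final leaf. *)
Fixpoint read_sym (fuel : nat) (acc : seq sym) : cmd :=
  if fuel is n.+1 then
    Case rT (fun o =>
      if o is Some SB
      then Seq (Case rT (fun _ => Skip)) (read_sym n (behead acc))
      else Push rA (head SA acc))
  else Skip.

Definition unload_loop : cmd :=
  Loop rT (fun o => o == Some SB)
    (fun o => if o is Some SB then read_sym 4 [:: SA; SB; SL; SR] else Skip).
Definition unload_cmd : cmd := Seq unload_loop (pour rA rT).

Lemma read_symP a r m : exec (read_sym 4 [:: SA; SB; SL; SR])
  (St (ser (encode a) ++ r) m [::] [::]) (St r (a :: m) [::] [::]) 12.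
Proof.
by case: a; do ?[apply: exec_caseT => /= | apply: (exec_le _ (push_A _ _ _ _ _)) |
  apply: (@ExecSeq _ _ _ _ _ 1 _ (exec_caseT (ExecSkip _ 0)))].
Qed.

Lemma unload_loopP (x m : seq sym) :
  exec unload_loop (St (ser (encode x)) m [::] [::])
    (St [::] (catrev x m) [::] [::]) (13 * size x + 1).
Proof.
elim: x m => [|a x IH] m.
  by apply: ExecDone; rewrite StE //= popE; apply: ExecSkip.
apply: (@exec_le _ _ _ (12 + (13 * size x + 1)).+1); first by rewrite /=; lia.
by apply: ExecLoop; last exact: (IH (a :: m)); rewrite StE //= popE; apply: read_symP.
Qed.

Lemma unload_cmdP x : exec unload_cmd (Stack (ser (encode x))) (Stack x) (15 * size x + 2).
Proof.
have -> : 15 * size x + 2 = (13 * size x + 1) + (2 * size (rev x) + 1).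
  by rewrite size_rev; lia.
apply: ExecSeq (unload_loopP x [::]) _.
by have := pour_AT (rev x) [::] [::] [::]; rewrite !catrevE !cats0 revK.
Qed.

Theorem ptime_turing (f : seq sym -> seq sym) : ptime f ->
  exists (W Q : finType) (delta : Q -> tsym W -> Q * tsym W * move) (q0 qf : Q) (c k : nat),
  forall x, exists2 t, t <= c * (size x) ^ k + c & tm_runs delta qf q0 x t (f x).
Proof.
move=> hf; have [d [l hd]] := ptime_size hf; case: hf => e [g [[c [k hg]] he]].
have [W [Q [delta [q0 [qf H]]]]] := cmd_turing (Seq load_cmd (Seq e unload_cmd)).
pose n x := (11 * size x + 3) + (g x + (15 * size (f x) + 2)).
have hn : pbound (fun x => n x * (2 * (size x + n x) + 4)).
  have h1 : pbound (fun x : seq sym => size x).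
    by apply: pbound_le pbound_esize => x; apply: ltnW; apply: size_esize.
  have h2 : pbound (fun x => size (f x)).
    exists d, l => x; apply: leq_trans (hd x); apply: ltnW; apply: size_esize.
  have h3 : pbound g by exists c, k.
  by rewrite /n; pb.
case: hn => c' [k' hn].
(* The code of a nonempty word is at most nine times as long as the word; the additive constant
   takes care of the empty one. *)
exists W, Q, delta, q0, qf, (c' * 9 ^ k'), k' => x.
have st0 s : input_stacks s = Stack s.
  by apply/ffunP => -[[] []]; rewrite !ffunE.
have ex : exec (Seq load_cmd (Seq e unload_cmd)) (input_stacks x) (input_stacks (f x)) (n x).
  rewrite !st0 /n; apply: ExecSeq (load_cmdP x) _; apply: ExecSeq (unload_cmdP _).
  by have := he x [::]; rewrite !cats0.
have [t le ht] := H _ _ _ ex; exists t => //.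
apply: leq_trans le _; apply: leq_trans (hn x) _.
rewrite -mulnA -mulnDr leq_mul2l; apply/orP; right.
case: (posnP (size x)) => [/size0nil ->|x0]; first by rewrite exp1n addn_gt0 expn_gt0 orbT.
rewrite -expnMn; apply: leq_trans (leq_addr _ _).
have le : esize x <= 9 * size x by apply: leq_trans (esize_word x) _; lia.
by case: (k') => // k2; rewrite leq_exp2r.
Qed.

(** * Correctness of elimination *)

Lemma mem_assign u x b s : (u \in assign x b s) = if u == x then b else u \in s.
Proof.
rewrite /assign; case: b; first by rewrite inE; case: eqP.
by rewrite mem_filter; case: eqP.
Qed.

Lemma eq_cost fs s t :
  (forall u, has (incident u) fs -> (u \in s) = (u \in t)) -> cost fs s = cost fs t.
Proof.
move=> h; congr sumn; apply/eq_in_map => f fin.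
by congr fval; apply: h; apply/hasP; exists f; rewrite // /incident eqxx ?orbT.
Qed.

Lemma cost_filterC p fs s :
  cost [seq f <- fs | p f] s + cost [seq f <- fs | ~~ p f] s = cost fs s.
Proof.
elim: fs => // f fs IH; have -> : cost (f :: fs) s =
  fval f (f.1.1 \in s) (f.1.2 \in s) + cost fs s by [].
by rewrite -IH /=; case: (p f) => /=; rewrite /cost /=; lia.
Qed.

Lemma fval_new_factor x y z fs a b :
  fval (new_factor x y z fs) a b = min_entry x y z fs a b.
Proof. by case: a; case: b. Qed.

Lemma nbrs_head2 x fs u : size (nbrs x fs) <= 2 -> u \in nbrs x fs ->
  let y := head x (nbrs x fs) in u = y \/ u = head y (behead (nbrs x fs)).
Proof.
case: (nbrs x fs) => [|y [|z [|]]] //= _; rewrite !inE.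
  by move/eqP; left.
by case/orP => /eqP; [left|right].
Qed.

(** Factors without [x] ignore its value, and factors with [x] read only [x] and its neighbours [y],
    [z], so for them [s] may be cut down to these three variables. The common part is then moved
    inside the minimum. *)
Lemma cost_eliminate x fs s : size (nbrs x fs) <= 2 ->
  cost (eliminate x fs) s = minn (cost fs (assign x false s)) (cost fs (assign x true s)).
Proof.
move=> n2; rewrite /eliminate; set y := head _ _; set z := head _ _.
set fx := [seq f <- fs | incident x f]; set f0 := [seq f <- fs | ~~ incident x f].
have c0 b : cost f0 (assign x b s) = cost f0 s.
  apply: eq_cost => u /hasP[f]; rewrite mem_filter mem_assign => /andP[nx _] uf.
  by case: eqP nx => // <-; rewrite uf.
have cx b : cost fx (assign x b (assign y (y \in s) (assign z (z \in s) [::]))) =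
    cost fx (assign x b s).
  apply: eq_cost => u /hasP[f]; rewrite mem_filter => /andP[fx' fin] uf.
  rewrite !mem_assign; case: (u =P x) => // /eqP ux.
  have : u \in nbrs x fs.
    by rewrite mem_nbrs ux; apply/hasP; exists f => //; rewrite fx'.
  case/(nbrs_head2 n2) => -> /=; first by rewrite eqxx.
  by rewrite -/y -/z eqxx; case: eqP => // ->.
have -> : cost (new_factor x y z fx :: f0) s = min_entry x y z fx (y \in s) (z \in s) + cost f0 s.
  by rewrite -fval_new_factor.
rewrite /min_entry !cx addn_minl.
by rewrite -(c0 false) {2}(c0 false) -(c0 true) !cost_filterC.
Qed.

(** The recursive form of [optimize], suited to induction; [optimize] itself is iterative in order
    to lie in the class of polynomial-time functions. *)
Fixpoint solve (n : nat) (vs : seq nat) (fs : seq factor) : seq nat :=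
  if n is n'.+1 then
    let x := pick_var vs fs in
    best fs x (solve n' [seq y <- vs | y != x] (eliminate x fs))
  else [::].

Lemma foldl_elim_step n vs fs tr :
  foldl (fun s p => best p.2 p.1 s) [::] (iter n elim_step ((vs, fs), tr)).2 =
  foldl (fun s p => best p.2 p.1 s) (solve n vs fs) tr.
Proof. by elim: n vs fs tr => // n IH vs fs tr; rewrite iterSr IH. Qed.

Lemma best_le fs x s b : cost fs (best fs x s) <= cost fs (assign x b s).
Proof. by rewrite /best; case: b; case: ltnP => // /ltnW. Qed.

(** * Optimality from an abstract invariant of elimination *)

Section Optimality.
Variable inv : seq nat -> seq factor -> Prop.
Hypothesis inv_small : forall v vs fs, inv (v :: vs) fs ->
  exists2 x, x \in v :: vs & size (nbrs x fs) <= 2.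
Hypothesis inv_elim : forall vs fs x, inv vs fs -> x \in vs -> size (nbrs x fs) <= 2 ->
  inv [seq y <- vs | y != x] (eliminate x fs).

(** By induction the recursive result minimises the cost after elimination, which is the minimum
    over [x] of the original cost, and [best] attains that minimum. Costs depend only on the
    variables in [vs], so they are constant once none is left. *)
Lemma solve_optimal n vs fs : uniq vs -> size vs = n -> inv vs fs ->
  (forall s t, {in vs, s =i t} -> cost fs s = cost fs t) ->
  forall s, cost fs (solve n vs fs) <= cost fs s.
Proof.
elim: n vs fs => [|n IH] vs fs uv sv iv ind s.
  by case: vs sv {uv iv} ind => // _ ind; rewrite (ind _ s).
have [px px2] : pick_var vs fs \in vs /\ size (nbrs (pick_var vs fs) fs) <= 2.
  case: vs sv iv {uv ind} => // v vs _ /inv_small[x xin x2].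
  have : x \in [seq x <- v :: vs | size (nbrs x fs) <= 2] by rewrite mem_filter x2.
  rewrite /pick_var; case e: (filter _ _) => [|u l] // _.
  have : u \in [seq x <- v :: vs | size (nbrs x fs) <= 2] by rewrite e mem_head.
  by rewrite mem_filter => /andP[].
rewrite /=; set x := pick_var vs fs in px px2 *; set vs' := filter _ vs.
have {}IH := IH vs' (eliminate x fs) (filter_uniq _ uv) _ (inv_elim iv px px2).
have sv' : size vs' = n.
  have -> : vs' = rem x vs by rewrite rem_filter.
  by rewrite size_rem // sv.
set s' := solve _ _ _.
have : cost (eliminate x fs) s' <= cost (eliminate x fs) s.
  apply: IH => // {}s t st; rewrite !cost_eliminate //.
  by congr minn; apply: ind => u uin; rewrite !mem_assign; case: eqP => // /eqP ux;
    apply: st; rewrite mem_filter ux.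
rewrite !cost_eliminate // => le.
have h1 : cost fs (best fs x s') <= minn (cost fs (assign x false s')) (cost fs (assign x true s')).
  by rewrite leq_min !best_le.
apply: leq_trans h1 (leq_trans le _).
have -> : cost fs s = cost fs (assign x (x \in s) s).
  by apply: eq_cost => u _; rewrite mem_assign; case: eqP => // ->.
by case: (x \in s); rewrite geq_min leqnn ?orbT.
Qed.
End Optimality.

(** * Low-degree variables and contraction in tree decompositions *)

Section Decomposition.
Variables (p : nat) (par : 'I_p.+1 -> 'I_p.+1).
Hypothesis par_lt : forall i : 'I_p.+1, 0 < i -> par i < i.
Implicit Types (vs : seq nat) (fs : seq factor) (bag : 'I_p.+1 -> seq nat) (top : nat -> 'I_p.+1).

(* The nodes whose bags contain x form a subtree with root top x. *)
Definition rooted bag top (x : nat) : Prop :=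
  x \in bag (top x) /\
  forall i, x \in bag i -> i != top x -> 0 < i /\ x \in bag (par i).

(** Bags are lists, possibly with repetitions, so that contraction is a [map] and preserves their
    size. Only factors that contain a remaining variable are constrained, because constant factors
    may still mention eliminated ones. *)
Definition decomposes bag top vs fs : Prop :=
  [/\ forall i, size (bag i) <= 3,
      forall x, x \in vs -> rooted bag top x
    & forall f u v, f \in fs -> u \in vs -> incident u f -> incident v f -> v != u ->
        v \in vs /\ exists i, (u \in bag i) && (v \in bag i)].

Lemma rooted_le bag top x i : rooted bag top x -> x \in bag i -> top x <= i.
Proof.
case=> _ h; have [n] := ubnP i; elim: n i => // n IH i; rewrite ltnS => le xi.
case: (i =P top x) => [->//|/eqP ne]; have [i0 xp] := h i xi ne.
apply: leq_trans (IH _ _ xp) (ltnW (par_lt i0)).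
exact: leq_trans (par_lt i0) le.
Qed.

(** Climbing from a common node, both variables persist: the node cannot be [top y] before [top x]
    is reached, since parents have smaller numbers. Thus the later of the two roots lies in both
    subtrees. *)
Lemma rooted_mem bag top x y i : rooted bag top x -> rooted bag top y ->
  x \in bag i -> y \in bag i -> top y <= top x -> y \in bag (top x).
Proof.
move=> rx ry; have [n] := ubnP i; elim: n i => // n IH i; rewrite ltnS => le xi yi yx.
case: (i =P top x) => [<-//|/eqP ne].
have [_ hx] := rx; have [_ hy] := ry; have [i0 xp] := hx i xi ne.
apply: (IH (par i)) => //; first exact: leq_trans (par_lt i0) le.
have ny : i != top y.
  apply: contraNneq ne => e; apply/eqP/val_inj/eqP; rewrite eqn_leq.
  by rewrite (rooted_le rx xi) andbT e.
by have [] := hy i yi ny.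
Qed.

(** Take [x] with the largest root. All its neighbours then occur in the bag of that root, where [x]
    itself occupies one of the three places. *)
Lemma decomposes_small bag top v vs fs : decomposes bag top (v :: vs) fs ->
  exists2 x, x \in v :: vs & size (nbrs x fs) <= 2.
Proof.
case=> sz rt ed.
have [x xin xmax] : exists2 x, x \in v :: vs & forall y, y \in v :: vs -> top y <= top x.
  elim: (vs) v {rt ed} => [|w l IH] v.
    by exists v; rewrite ?mem_head // => y; rewrite inE => /eqP ->.
  have [x xin xm] := IH w; case: (leqP (top x) (top v)) => le.
    exists v; rewrite ?mem_head // => y; rewrite inE => /predU1P[->//|/xm h].
    exact: leq_trans h le.
  exists x; first by rewrite inE xin orbT.
  by move=> y; rewrite inE => /predU1P[->|/xm //]; apply: ltnW.
exists x => //; have rx := rt x xin.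
have sub : {subset nbrs x fs <= [seq y <- bag (top x) | y != x]}.
  move=> u; rewrite mem_nbrs => /andP[ux /hasP[f fin /andP[fx fu]]].
  have [uin [i /andP[xi ui]]] := ed f x u fin xin fx fu ux.
  by rewrite mem_filter ux (rooted_mem rx (rt u uin) xi ui (xmax u uin)).
apply: leq_trans (uniq_leq_size (nbrs_uniq x fs) sub) _.
have [xb _] := rx; have := sz (top x); rewrite size_filter.
rewrite -(count_predC (fun y => y != x)).
have : 0 < count (predC (fun y => y != x)) (bag (top x)).
  by rewrite -has_count; apply/hasP; exists x => //=; rewrite eqxx.
by lia.
Qed.

(** Serves the elimination of a variable without neighbours, whose new factor mentions only that
    variable. *)
Lemma decomposes_sub bag top vs fs fs' x : decomposes bag top vs fs ->
  (forall f, f \in fs' ->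
     f \in fs /\ ~~ incident x f \/ (forall u, incident u f -> u = x)) ->
  decomposes bag top [seq y <- vs | y != x] fs'.
Proof.
case=> sz rt ed sub; split=> // [y|f u v fin]; first by rewrite mem_filter => /andP[_ /rt].
rewrite mem_filter => /andP[ux uin] uf vf vu.
case: (sub f fin) => [[fin' nx]|/(_ u uf) e]; last by rewrite e eqxx in ux.
have [vin ?] := ed f u v fin' uin uf vf vu; split=> //.
by rewrite mem_filter vin andbT; apply: contraTneq vf => ->.
Qed.

(* Contracting x into its neighbour y in every bag puts the two neighbours of x
   in a common bag. *)
Lemma decomposes_elim bag top vs fs x : decomposes bag top vs fs -> x \in vs ->
  size (nbrs x fs) <= 2 ->
  exists bag' top', decomposes bag' top' [seq y <- vs | y != x] (eliminate x fs).
Proof.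
move=> dec xin n2; have [sz rt ed] := dec.
have nbr u : u \in nbrs x fs -> [/\ u != x, u \in vs & exists i, (x \in bag i) && (u \in bag i)].
  rewrite mem_nbrs => /andP[ux /hasP[f fin /andP[fx fu]]].
  by have [? ?] := ed f x u fin xin fx fu ux.
rewrite /eliminate; case e: (nbrs x fs) n2 nbr => [|y l] n2 nbr.
  exists bag, top; apply: decomposes_sub dec _ => f; rewrite inE mem_filter.
  by case/orP => [/eqP ->|/andP[? ?]]; [right=> u /orP[] /eqP | left].
have [yx yin [i0 /andP[xi0 yi0]]] := nbr y (mem_head _ _).
pose rho u := if u == x then y else u.
pose bag' i := map rho (bag i).
(* Two intersecting subtrees have a subtree as union, rooted at the earlier of their roots. *)
pose t := if top x < top y then top x else top y.
pose top' u := if u == y then t else top u.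
have mem' u i : u != x -> (u \in bag' i) = (u \in bag i) || (u == y) && (x \in bag i).
  move=> ux; apply/mapP/orP => [[w win ->]|[uin|/andP[/eqP -> xi]]].
  - by rewrite /rho; case: eqP => [<-|_]; [right; rewrite eqxx | left].
  - by exists u => //; rewrite /rho (negbTE ux).
  - by exists x => //; rewrite /rho eqxx.
have rx := rt x xin; have ry := rt y yin.
exists bag', top'; split=> [i|u|f u v].
- by rewrite size_map.
- rewrite mem_filter => /andP[ux uin]; rewrite /rooted !mem' //.
  have [uy|uy] := eqVneq u y; last first.
    rewrite /top' (negbTE uy) orbF; have [h1 h2] := rt u uin; split=> // i.
    by rewrite !mem' // (negbTE uy) !orbF; apply: h2.
  rewrite /top' uy eqxx /=; split.
    by rewrite /t; case: ifP => _; [have [->] := rx; rewrite orbT | have [->] := ry].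
  move=> i; rewrite !mem' ?eqxx //= => /orP[yi|xi] it.
    have [iy|iy] := eqVneq i (top y); last by have [_ h] := ry; have [? ->] := h i yi iy.
    move: it; rewrite /t iy; case: ltnP => [lt _|]; last by rewrite eqxx.
    (* If [top y] is not the root of the union, it lies inside the subtree of [x], so its parent
       contains [x], which is renamed to [y]. *)
    have ty := rooted_mem ry rx yi0 xi0 (ltnW lt).
    have [_ h] := rx; have [|? ->] := h (top y) ty; last by rewrite orbT.
    by apply: contraTneq lt => ->; rewrite ltnn.
  have [ix|ix] := eqVneq i (top x); last first.
    by have [_ h] := rx; have [? ->] := h i xi ix; rewrite orbT.
  move: it; rewrite /t ix; case: ltnP => [|le ne]; first by rewrite eqxx.
  have ty := rooted_mem rx ry xi0 yi0 le.
  by have [_ h] := ry; have [? ->] := h (top x) ty ne.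
rewrite inE => /orP[/eqP ->|]; last first.
  rewrite !mem_filter => /andP[nx fin] /andP[ux uin] uf vf vu.
  have [vin [i /andP[h1 h2]]] := ed f u v fin uin uf vf vu.
  have vx : v != x by apply: contraNneq nx => <-.
  by split; [rewrite vx | exists i; rewrite !mem' // h1 h2].
have hz : head y l \in y :: l by case: (l) => [|w l'] /=; rewrite !inE eqxx ?orbT.
have [zx zin [i /andP[xi zi]]] := nbr _ hz.
have yi' : y \in bag' i by rewrite mem' // eqxx xi orbT.
have zi' : head y l \in bag' i by rewrite mem' // zi.
rewrite !mem_filter => /andP[ux uin] /orP[] /eqP /= eu /orP[] /eqP /= ev; rewrite -?eu -?ev ?eqxx // => _.
  by rewrite zx zin; split=> //; exists i; rewrite yi' zi'.
by rewrite yx yin; split=> //; exists i; rewrite yi' zi'.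
Qed.
End Decomposition.

(** * The factors of an instance *)

Section SubtreeRoot.
Variables (p : nat) (par : 'I_p.+1 -> 'I_p.+1) (P : pred 'I_p.+1).
Hypothesis par_lt : forall i : 'I_p.+1, 0 < i -> par i < i.

(* par is unconstrained at the root 0, hence the side condition on the path. *)
Let below (i u : 'I_p.+1) := exists2 k, iter k par u = i &
  forall l, l < k -> 0 < iter l par u.

Lemma below_le i u : below i u -> i <= u.
Proof.
case=> k <-; elim: k => // k IH h; apply: leq_trans (IH _).
  by rewrite iterS ltnW // par_lt // h.
by move=> l lk; apply: h; apply: ltnW.
Qed.

(** If the parent of [i] were outside [P], a path within [P] from [i] to [t] could never leave the
    part of the tree below [i], whose numbers are at least [i]; but [t] is smaller. *)
Lemma subtree_root t :
  (forall a b, P a -> P b ->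
     connect [rel u v | [&& P u, P v & tree_adj par u v]] a b) ->
  P t -> (forall i, P i -> t <= i) ->
  forall i, P i -> i != t -> 0 < i /\ P (par i).
Proof.
move=> conn Pt tmin i Pi it.
have lt : t < i by rewrite ltn_neqAle tmin // andbT eq_sym.
split; first exact: leq_ltn_trans lt.
apply: contraLR lt => nP; rewrite -leqNgt; apply: below_le.
have /connectP[q qp ->] := conn i t Pi Pt.
have : below i i by exists 0.
move: {1 3 5}i qp => u; elim: q u => //= v q IH u /andP[/and3P[Pu Pv adj] vq] [k ku kpos].
(* An upward edge stays below [i] unless it starts at [i], where it would enter the excluded parent;
   a downward edge lengthens the chain by one. *)
apply: IH vq _; case/orP: adj => /andP[pos /eqP e].
  case: k ku kpos => [|k] ku kpos; first by move: nP; rewrite -ku /= e Pv.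
  by exists k; rewrite -e -?iterSr // => l lk; rewrite -iterSr; apply: kpos.
exists k.+1; first by rewrite iterSr e.
by case=> // l lk; rewrite iterSr e; apply: kpos.
Qed.
End SubtreeRoot.

Lemma parentP d j : parent d j = j \/ (parent d j, j) \in d.1.
Proof.
rewrite /parent; case e: [seq _ | _ <- _ & _] => [|u l]; [by left | right].
have : u \in [seq e.1 | e <- d.1 & e.2 == j] by rewrite e mem_head.
case/mapP => -[a b]; rewrite mem_filter => /andP[/= /eqP -> abin] /= ->.
exact: abin.
Qed.

Section Instance.
Variable I : instance.
Hypotheses (wf : wf_instance I) (indeg : max_indeg_le1 I).
Let m := nissues I.
Let fs := instance_factors m (map data_of (voters I)).

Lemma mem_instance_factors f : f \in fs ->
  exists i j, [/\ i < size (voters I), j < m &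
    f = issue_factor (data_of (nth voter0 (voters I) i)) j].
Proof.
case/flatten_mapP => d /(nthP (data_of voter0))[i]; rewrite size_map => isz <- /mapP[j].
rewrite mem_iota /= => jm ->; exists i, j; split=> //.
by rewrite (nth_map voter0).
Qed.

(** Well-formedness puts the variable of a literal among the in-neighbours; there is at most one, so
    it is the head of the list from which [parent] is read. *)
Lemma mem_vapp_parent i j st q : i < size (voters I) -> j < m ->
  let v := nth voter0 (voters I) i in
  st \in nth [::] (vapp v) j -> q \in st.1 -> q.1 = parent (data_of v) j /\ q.1 < m.
Proof.
move=> isz jm v stin qin; have [ed _ ap] := wf isz; have [_ pe] := ap j jm st stin.
have : q.1 \in in_nbrs v j by rewrite -(perm_mem pe) map_f.
have := indeg isz jm; rewrite -/v /parent /in_nbrs.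
set l := map _ _ => szl ql; have := ql; rewrite mem_undup => /[dup] ql'.
case/mapP => e; rewrite mem_filter => /andP[_ ein] eq1; split; last first.
  by rewrite eq1; have [] := ed e ein.
rewrite /= -/l; have : head j l \in undup l by rewrite mem_undup; case: (l) ql' => //= *; rewrite mem_head.
by case: (undup l) szl ql => [|a [|]] //= _; rewrite !inE => /eqP -> /eqP ->.
Qed.

Lemma dissat_rejected i j s (S : seq nat) : i < size (voters I) -> j < m ->
  (forall k, k < m -> nth false s k = (k \in S)) ->
  let v := nth voter0 (voters I) i in
  dissat v j s = rejected (nth [::] (vapp v) j) (j \in S) (parent (data_of v) j \in S).
Proof.
move=> isz jm sS v; rewrite /dissat /rejected; congr (~~ _); apply: eq_in_has => st stin /=.
rewrite sS //; congr (_ && _); apply: eq_in_all => q qin.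
have [e qm] := mem_vapp_parent isz jm stin qin.
by rewrite sS // e eq_sym.
Qed.

Lemma cost_sum l S : cost l S = \sum_(f <- l) fval f (f.1.1 \in S) (f.1.2 \in S).
Proof. by rewrite /cost sumnE big_map. Qed.

Lemma cms_cost_factors s (S : seq nat) : (forall k, k < m -> nth false s k = (k \in S)) ->
  cms_cost I s = cost fs S.
Proof.
move=> sS; rewrite cost_sum /fs /instance_factors big_flatten !big_map /cms_cost.
rewrite (big_nth voter0) [RHS](big_nth voter0); apply: eq_big_nat => i /andP[_ isz].
have -> : iota 0 m = index_iota 0 m by rewrite /index_iota subn0.
rewrite big_map big_mkord; apply: eq_bigr => j _.
rewrite (dissat_rejected isz _ sS) //.
by rewrite /issue_factor /fval /=; case: (_ \in S); case: (_ \in S).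
Qed.

Lemma issue_factor_bound f u : f \in fs -> incident u f -> u < m.
Proof.
case/mem_instance_factors => i [j [isz jm ->]] /orP[] /eqP /= <- //.
case: (parentP (data_of (nth voter0 (voters I) i)) j) => [-> //|].
by have [ed _ _] := wf isz; case/ed.
Qed.

Lemma instance_decomposes : treewidth_le (@und_global I) 2 ->
  exists p (par : 'I_p.+1 -> 'I_p.+1) bag top,
    (forall i : 'I_p.+1, 0 < i -> par i < i) /\
    decomposes par bag top (iota 0 m) fs.
Proof.
case=> p [par [bag [par_lt cover edge conn width]]].
(* Parents have smaller numbers, so the root of a subtree is its least node. *)
pose root (x : 'I_m) := [arg min_(i < xchoose (cover x) | x \in bag i) (i : nat)].
pose top (y : nat) := if insub y is Some x then root x else ord0.
pose bag' i := [seq val x | x <- enum (bag i)].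
have mem_bag' (x : 'I_m) i : (val x \in bag' i) = (x \in bag i).
  by rewrite mem_map ?mem_enum //; apply: val_inj.
exists p, par, bag', top; split=> //; split.
- by move=> i; rewrite size_map -cardE.
- move=> y; rewrite mem_iota /= => ym; pose x : 'I_m := Ordinal ym.
  have -> : y = val x by []; rewrite /rooted /top valK /root.
  case: arg_minnP => [|t xt tmin]; first exact: (xchooseP (cover x)).
  rewrite mem_bag'; split=> // i; rewrite !mem_bag' => xi it.
  exact: (subtree_root (P := fun i => x \in bag i) par_lt (conn x) xt tmin xi it).
move=> f u v fin _ uf vf vu; have um := issue_factor_bound fin uf.
have vm := issue_factor_bound fin vf; rewrite mem_iota; split=> //.
(* Distinct variables of a factor are an issue and its parent for some voter, joined by an edge in
   one of the two orientations. *)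
suff : und_global (Ordinal um) (Ordinal vm).
  by case/edge => i /andP[ui vi]; exists i; rewrite (mem_bag' (Ordinal um)) ui (mem_bag' (Ordinal vm)) vi.
have [i [j [isz jm ef]]] := mem_instance_factors fin.
have ed := parentP (data_of (nth voter0 (voters I) i)) j.
rewrite /und_global /= -(inj_eq val_inj) /= eq_sym vu; apply/(has_nthP voter0); exists i => //.
move: uf vf; rewrite ef /incident /= => /orP[] /eqP eu /orP[] /eqP ev.
- by move: vu; rewrite -eu -ev eqxx.
- by case: ed => [e|]; [move: vu; rewrite -eu -ev e eqxx | rewrite -eu -ev => h; apply/orP; right].
- by case: ed => [e|]; [move: vu; rewrite -eu -ev e eqxx | rewrite -eu -ev => h; apply/orP; left].
- by move: vu; rewrite -eu -ev eqxx.
Qed.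

Lemma optimize_optimal : treewidth_le (@und_global I) 2 ->
  forall S, cost fs (optimize m fs) <= cost fs S.
Proof.
case/instance_decomposes => p [par [bag [top [par_lt dec]]]] S.
rewrite /optimize foldl_elim_step /=.
apply: (@solve_optimal (fun vs fs => exists bag top, decomposes par bag top vs fs)).
- by move=> v vs gs [b [t d]]; apply: decomposes_small d.
- by move=> vs gs x [b [t d]] xin x2; apply: decomposes_elim d xin x2.
- exact: iota_uniq.
- exact: size_iota.
- by exists bag, top.
move=> s t st; apply: eq_cost => u /hasP[f fin uf].
by apply: st; rewrite mem_iota (issue_factor_bound fin uf).
Qed.
End Instance.

Theorem theorem3 :
  exists (W Q : finType) (delta : Q -> tsym W -> Q * tsym W * move)
         (q0 qf : Q) (c k : nat),
  forall I : instance,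
    wf_instance I ->
    max_indeg_le1 I ->
    treewidth_le (@und_global I) 2 ->
    exists (t : nat) (s : seq bool),
      t <= c * (size (enc_instance I)) ^ k + c /\
      tm_runs delta qf q0 (enc_instance I) t (enc_outcome s) /\
      cms_optimal I s.
Proof.
have [W [Q [delta [q0 [qf [c [k H]]]]]]] := ptime_turing ptime_solver.
exists W, Q, delta, q0, qf, c, k => I wf indeg tw.
have [t tle] := H (enc_instance I).
pose m := nissues I; pose fs := instance_factors m (map data_of (voters I)).
pose S := optimize m fs; exists t, (mkseq (fun j => j \in S) m); split=> //; split.
  suff -> : enc_outcome (mkseq (fun j => j \in S) m) = solver (enc_instance I) by [].
  rewrite /solver parse_instanceP /enc_outcome /enc_list /outcome_word -map_comp.
  by congr (_ :: flatten _ ++ _); apply: eq_map => j /=; rewrite -/m -/fs -/S; case: (j \in S).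
split=> [|s' sz]; first by rewrite size_mkseq.
have eS j : j < m -> nth false (mkseq (fun j => j \in S) m) j = (j \in S).
  by move=> jm; rewrite nth_mkseq.
(* A competing outcome is represented by the list of its true issues, to which the optimality over
   lists applies. *)
have eS' j : j < m -> nth false s' j = (j \in [seq j <- iota 0 m | nth false s' j]).
  by move=> jm; rewrite mem_filter mem_iota leq0n add0n [j < m]jm; case: nth.
rewrite (cms_cost_factors wf indeg eS) (cms_cost_factors wf indeg eS').
exact: optimize_optimal.
Qed.
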